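(* Let $V$ be a smooth manifold with a smooth action of a finite group $G$. Then $C^\infty(V)$ is finitely generated as a $C^\infty(V)^G$-module.
   Context: $C^\infty(V)$ is the algebra of smooth complex-valued functions on $V$ (a manifold without boundary), and $C^\infty(V)^G$ is its subalgebra of $G$-invariant functions. *)

(* Defs.v *)
From HB Require Import structures.
From mathcomp Require Import all_boot all_order all_algebra all_fingroup.
From mathcomp Require Import complex.
From mathcomp Require Import all_classical all_reals all_analysis.
Set Implicit Arguments.
Unset Strict Implicit.
Unset Printing Implicit Defensive.
Import Order.TTheory GRing.Theory Num.Theory.
Import numFieldNormedType.Exports.

Local Open Scope classical_set_scope.
Local Open Scope ring_scope.

Section Euclidean.
Context {R : realType} {n : nat}.
Implicit Types U : set 'rV[R]_n.

(* C^k on an open set U.  Only the values of f on U matter, since U is open;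
   f is C^(k+1) when it is Fréchet differentiable on U and x |-> 'd f x is C^k,
   and in finite dimension the latter can be tested by evaluating 'd f x at
   each vector v, which gives 'D_v f x. *)
Fixpoint Ck_on {W : normedModType R} (k : nat) U (f : 'rV[R]_n -> W) : Prop :=
  match k with
  | 0 => forall x, U x -> {for x, continuous f}
  | k'.+1 => (forall x, U x -> differentiable f x) /\
             (forall v, Ck_on k' U ('D_v f))
  end.

Definition smooth_on {W : normedModType R} U (f : 'rV[R]_n -> W) : Prop :=
  forall k, Ck_on k U f.

End Euclidean.

(* A homeomorphism from an open subset of M onto an open subset of R^n;
   chart_map outside chart_dom, and chart_inv outside the image of chart_dom,
   are junk values. *)
Record chart (R : realType) (n : nat) (M : topologicalType) := Chart {
  chart_dom : set M;
  chart_map : M -> 'rV[R]_n;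
  chart_inv : 'rV[R]_n -> M;
  chart_dom_open : open chart_dom;
  chart_img_open : open (chart_map @` chart_dom);
  chart_mapK : forall x, chart_dom x -> chart_inv (chart_map x) = x;
  chart_map_continuous : {within chart_dom, continuous chart_map};
  chart_inv_continuous :
    {within chart_map @` chart_dom, continuous chart_inv} }.

(* The second condition is imposed on all ordered pairs of charts, so that each
   transition map is a diffeomorphism between open subsets of R^n. *)
Definition smooth_atlas (R : realType) (n : nat) (M : topologicalType)
    (A : set (chart R n M)) : Prop :=
  (forall x, exists2 c, A c & chart_dom c x) /\
  (forall c d, A c -> A d ->
     smooth_on (chart_map c @` (chart_dom c `&` chart_dom d))
       (chart_map d \o chart_inv c)).

(* Smooth n-manifold without boundary: Hausdorff, second countable, possibly
   empty or disconnected.  The atlas need not be maximal. *)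
Record manifold (R : realType) (n : nat) := Manifold {
  carrier :> topologicalType;
  manifold_hausdorff : hausdorff_space carrier;
  manifold_second_countable : @second_countable carrier;
  atlas : set (chart R n carrier);
  atlasP : smooth_atlas atlas }.

Definition smooth_map (R : realType) (m n : nat)
    (M : manifold R m) (N : manifold R n) (F : M -> N) : Prop :=
  continuous F /\
  forall c d, atlas c -> atlas d ->
    smooth_on (chart_map c @` (chart_dom c `&` F @^-1` chart_dom d))
      (chart_map d \o F \o chart_inv c).

(* {action gT &-> M} is a right action; a left action g . x is to x g^-1, and
   this change affects neither smoothness nor the invariant functions. *)
Definition smooth_action (R : realType) (n : nat) (M : manifold R n)
    (gT : finGroupType) (to : {action gT &-> M}) : Prop :=
  forall g : gT, @smooth_map R n n M M (fun x => to x g).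

Definition smooth_real (R : realType) (n : nat) (M : manifold R n)
    (f : M -> R) : Prop :=
  forall c, atlas c -> smooth_on (chart_map c @` chart_dom c) (f \o chart_inv c).

Definition smooth_fun (R : realType) (n : nat) (M : manifold R n)
    : {pred M -> R[i]} :=
  [pred f : M -> R[i] | `[< smooth_real (fun x => complex.Re (f x)) /\
                            smooth_real (fun x => complex.Im (f x)) >]].
Arguments smooth_fun {R n} M.

Lemma near_eq_differentiable (R : realType) (V W : normedModType R)
    (f g : V -> W) (x : V) :
  {near x, f =1 g} -> differentiable f x -> differentiable g x.
Proof.
move=> fg /diff_locallyP[dfc /eqaddoP fE].
have gE : g \o shift x = cst (g x) + 'd f x +o_ 0 id.
  apply/eqaddoP => e e0; have fe := fE e e0.
  have fg0 : \forall h \near 0, f (h + x) = g (h + x).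
    by move: fg; rewrite (near_shift 0) subr0.
  near=> h.
  have fgx : f x = g x := nbhs_singleton fg.
  have fgh : f (h + x) = g (h + x) by near: h.
  have : `|(f \o shift x - (cst (f x) + 'd f x)) h| <= e * `|h| by near: h.
  by rewrite !fctE /= /cst fgx fgh.
apply/diff_locallyP.
by have -> : 'd g x = 'd f x :> (V -> W) by exact: diff_unique.
Unshelve. all: by end_near. Qed.

Section CkTheory.
Context {R : realType} {n : nat}.
Implicit Types (k : nat) (U : set 'rV[R]_n).

Lemma Ck_on_eq {W : normedModType R} k U (f g : 'rV[R]_n -> W) :
  open U -> {in U, f =1 g} -> Ck_on k U f -> Ck_on k U g.
Proof.
move=> oU; have nfg (f' g' : 'rV[R]_n -> W) x :
    {in U, f' =1 g'} -> U x -> {near x, f' =1 g'}.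
  move=> fg' Ux; apply: filterS (open_nbhs_nbhs (conj oU Ux)) => y Uy.
  exact/fg'/mem_set.
elim: k f g => [|k IH] f g fg /=.
  move=> cf x Ux; rewrite /prop_for /continuous_at -(fg x (mem_set Ux)).
  exact: cvg_trans (near_eq_cvg (nfg _ _ _ fg Ux)) (cf x Ux).
move=> [df Df]; split=> [x Ux|v].
  exact: near_eq_differentiable (nfg _ _ _ fg Ux) (df x Ux).
apply: IH (Df v) => x /set_mem Ux.
exact: near_eq_derive (nfg _ _ _ fg Ux).
Qed.

Lemma Ck_onW {W : normedModType R} k U (f : 'rV[R]_n -> W) :
  Ck_on k.+1 U f -> Ck_on k U f.
Proof.
elim: k f => [|k IH] f [df Df].
  by move=> x /df; exact: differentiable_continuous.
by split=> // v; exact/IH/Df.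
Qed.

Lemma Ck_on_cst {W : normedModType R} k U (a : W) : Ck_on k U (cst a).
Proof.
elim: k a => [|k IH] a /=; first by move=> x _; exact: cst_continuous.
split=> // v; suff -> : 'D_v (cst a) = cst 0 :> ('rV[R]_n -> W) by [].
by apply/funext => x; rewrite derive_cst.
Qed.

Lemma Ck_onD {W : normedModType R} k U (f g : 'rV[R]_n -> W) :
  open U -> Ck_on k U f -> Ck_on k U g -> Ck_on k U (f + g).
Proof.
move=> oU; elim: k f g => [|k IH] f g.
  by move=> cf cg x Ux; apply: continuousD; [exact: cf|exact: cg].
move=> [df Df] [dg Dg]; split=> [x Ux|v].
  by apply: differentiableD; [exact: df|exact: dg].
apply: Ck_on_eq oU _ (IH _ _ (Df v) (Dg v)) => x /set_mem Ux.
by rewrite deriveD//; apply: diff_derivable; [exact: df|exact: dg].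
Qed.

Lemma Ck_onN {W : normedModType R} k U (f : 'rV[R]_n -> W) :
  open U -> Ck_on k U f -> Ck_on k U (- f).
Proof.
move=> oU; elim: k f => [|k IH] f.
  by move=> cf x Ux; apply: continuousN; exact: cf.
move=> [df Df]; split=> [x Ux|v]; first by apply: differentiableN; exact: df.
apply: Ck_on_eq oU _ (IH _ (Df v)) => x /set_mem Ux.
by rewrite deriveN//; apply: diff_derivable; exact: df.
Qed.

Lemma Ck_onM k U (f g : 'rV[R]_n -> R) :
  open U -> Ck_on k U f -> Ck_on k U g -> Ck_on k U (f * g).
Proof.
move=> oU; elim: k f g => [|k IH] f g.
  by move=> cf cg x Ux; apply: continuousM; [exact: cf|exact: cg].
move=> Cf Cg; have [[df Df] [dg Dg]] := (Cf, Cg); split=> [x Ux|v].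
  by apply: differentiableM; [exact: df|exact: dg].
have fDg := IH _ _ (Ck_onW Cf) (Dg v); have gDf := IH _ _ (Ck_onW Cg) (Df v).
apply: Ck_on_eq oU _ (Ck_onD oU fDg gDf) => x /set_mem Ux.
by rewrite deriveM//; apply: diff_derivable; [exact: df|exact: dg].
Qed.

End CkTheory.

Section SmoothFunctions.
Context {R : realType} {n : nat} {M : manifold R n}.

Lemma smooth_real_cst (a : R) : @smooth_real R n M (cst a).
Proof. by move=> c _ k; exact: Ck_on_cst. Qed.

Lemma smooth_realD (f g : M -> R) :
  smooth_real f -> smooth_real g -> smooth_real (f + g).
Proof.
by move=> sf sg c Ac k;
  apply: Ck_onD; [exact: chart_img_open|exact: sf|exact: sg].
Qed.

Lemma smooth_realN (f : M -> R) : smooth_real f -> smooth_real (- f).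
Proof.
by move=> sf c Ac k; apply: Ck_onN; [exact: chart_img_open|exact: sf].
Qed.

Lemma smooth_realM (f g : M -> R) :
  smooth_real f -> smooth_real g -> smooth_real (f * g).
Proof.
by move=> sf sg c Ac k;
  apply: Ck_onM; [exact: chart_img_open|exact: sf|exact: sg].
Qed.

Fact smooth_fun_subring_closed : subring_closed (smooth_fun M).
Proof.
split.
- by apply/asboolP; split; exact: smooth_real_cst.
- move=> f g /asboolP[fr fi] /asboolP[gr gi]; apply/asboolP; split.
  + rewrite (_ : (fun _ => _) =
      (fun x => complex.Re (f x)) + - (fun x => complex.Re (g x))).
      exact: smooth_realD fr (smooth_realN gr).
    by apply/funext => x; rewrite !fctE raddfB.
  + rewrite (_ : (fun _ => _) =
      (fun x => complex.Im (f x)) + - (fun x => complex.Im (g x))).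
      exact: smooth_realD fi (smooth_realN gi).
    by apply/funext => x; rewrite !fctE raddfB.
- move=> f g /asboolP[fr fi] /asboolP[gr gi]; apply/asboolP; split.
  + rewrite (_ : (fun _ => _) =
      (fun x => complex.Re (f x)) * (fun x => complex.Re (g x)) +
      - ((fun x => complex.Im (f x)) * (fun x => complex.Im (g x)))).
      exact: smooth_realD (smooth_realM fr gr) (smooth_realN (smooth_realM fi gi)).
    by apply/funext => x; rewrite !fctE; case: (f x) (g x) => [a b] [a' b'].
  + rewrite (_ : (fun _ => _) =
      (fun x => complex.Re (f x)) * (fun x => complex.Im (g x)) +
      (fun x => complex.Im (f x)) * (fun x => complex.Re (g x))).
      exact: smooth_realD (smooth_realM fr gi) (smooth_realM fi gr).
    by apply/funext => x; rewrite !fctE; case: (f x) (g x) => [a b] [a' b'].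
Qed.

End SmoothFunctions.

Definition Cinfty (R : realType) (n : nat) (M : manifold R n) : Type :=
  {f : M -> R[i] | f \in smooth_fun M}.

HB.instance Definition _ (R : realType) n (M : manifold R n) :=
  SubChoice.copy (Cinfty M) {f : M -> R[i] | f \in smooth_fun M}.
HB.instance Definition _ (R : realType) n (M : manifold R n) :=
  GRing.SubChoice_isSubComPzRing.Build (M -> R[i]) (fun f => f \in smooth_fun M)
    (Cinfty M) smooth_fun_subring_closed.

Definition invariant_fun (R : realType) (n : nat) (M : manifold R n)
    (gT : finGroupType) (to : {action gT &-> M}) : {pred Cinfty M} :=
  [pred f : Cinfty M | `[< forall (g : gT) (x : M), \val f (to x g) = \val f x >]].

Section Invariants.
Context {R : realType} {n : nat} {M : manifold R n}.
Context {gT : finGroupType} (to : {action gT &-> M}).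

Fact invariant_fun_subring_closed : subring_closed (invariant_fun to).
Proof.
split; first by apply/asboolP.
- move=> f h /asboolP fi /asboolP hi; apply/asboolP => g x.
  by rewrite raddfB /= !fctE fi hi.
- move=> f h /asboolP fi /asboolP hi; apply/asboolP => g x.
  by rewrite rmorphM /= !fctE fi hi.
Qed.

Definition Cinfty_inv : Type := {f : Cinfty M | f \in invariant_fun to}.

HB.instance Definition _ :=
  SubChoice.copy Cinfty_inv {f : Cinfty M | f \in invariant_fun to}.
HB.instance Definition _ :=
  GRing.SubChoice_isSubComPzRing.Build (Cinfty M)
    (fun f => f \in invariant_fun to) Cinfty_inv invariant_fun_subring_closed.

End Invariants.

(* Alias of the additive group of Cinfty M; the phantom argument to selects the
   ring acting on it, and HB can then attach a module structure to it. *)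
Definition Cinfty_mod (R : realType) (n : nat) (M : manifold R n)
    (gT : finGroupType) (to : {action gT &-> M}) : Type := Cinfty M.

HB.instance Definition _ (R : realType) n (M : manifold R n)
    (gT : finGroupType) (to : {action gT &-> M}) :=
  GRing.Zmodule.copy (Cinfty_mod to) (Cinfty M).

Section InvariantModule.
Context {R : realType} {n : nat} {M : manifold R n}.
Context {gT : finGroupType} (to : {action gT &-> M}).

Definition Cinfty_scale (a : Cinfty_inv to) (f : Cinfty_mod to)
    : Cinfty_mod to :=
  (\val a : Cinfty M) * (f : Cinfty M).

Fact Cinfty_scaleA a b f :
  Cinfty_scale a (Cinfty_scale b f) = Cinfty_scale (a * b) f.
Proof. exact: mulrA. Qed.

Fact Cinfty_scale1 : left_id 1 Cinfty_scale.
Proof. exact: mul1r. Qed.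

Fact Cinfty_scaleDr : right_distributive Cinfty_scale +%R.
Proof. by move=> a f h; exact: mulrDr. Qed.

Fact Cinfty_scaleDl f : {morph Cinfty_scale^~ f : a b / a + b}.
Proof. by move=> a b; exact: mulrDl. Qed.

HB.instance Definition _ :=
  GRing.Zmodule_isLmodule.Build (Cinfty_inv to) (Cinfty_mod to)
    Cinfty_scaleA Cinfty_scale1 Cinfty_scaleDr Cinfty_scaleDl.

End InvariantModule.

Definition finitely_generated (A : pzRingType) (E : lmodType A) : Prop :=
  exists (k : nat) (e : 'I_k -> E),
    forall u : E, exists a : 'I_k -> A, u = \sum_(i < k) a i *: e i.

(* Main.v *)
(* It suffices to find finitely many smooth e_i such that every smooth u can be
   written u(gx) = sum_i a_i(x) e_i(gx) for all g in G, with a_i smooth but not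
   necessarily invariant: averaging the a_i over G makes them invariant.

   If u = w o F with F : V -> R^m and w : R^m -> R smooth, the monomials of
   degree < |G| in each F_l are such functions e_i.  Indeed F_l(gx) is a root of
   the monic polynomial prod_h (t - F_l(hx)), all of whose roots are real, so
   that w can be divided by it by Newton interpolation at the nodes F_l(hx); the
   divided differences are smooth by Hadamard's integral formula.

   To reduce to this case, V is cut into finitely many pieces, each of which is
   a locally finite disjoint union of compact subsets of charts: small cubes of
   a chart can be coloured with 2^n colours so that cubes of the same colour are
   disjoint, 2^n colours suffice then for every compact set, and 3 * 2^n colours
   for V, which is exhausted by compact annuli.  On such a piece the charts,
   together with one coordinate numbering them, are the restriction of a smooth
   F : V -> R^(n+1), and every smooth function is there of the form w o F. *)
Require Import Defs.
From HB Require Import structures.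
From mathcomp Require Import all_boot all_order all_algebra all_fingroup.
From mathcomp Require Import complex.
From mathcomp Require Import all_classical all_reals all_analysis.
From mathcomp Require Import ring lra.
Set Implicit Arguments.
Unset Strict Implicit.
Unset Printing Implicit Defensive.
Import Order.TTheory GRing.Theory Num.Theory.
Import numFieldNormedType.Exports.

Local Open Scope classical_set_scope.
Local Open Scope ring_scope.

(** * Calculus of C^k functions on R^n *)

(** Division of smooth functions by a general monic polynomial is a deep theorem (Malgrange). Here
    the roots are themselves smooth functions of the point, which makes it elementary: variables and
    nodes become independent coordinates of one space R^N, where divided differences stay smooth
    even when nodes coincide. The generators depend on F alone; everything that depends on u sits in
    the coefficients.

    The obstacle on a noncompact V is finiteness: a locally finite atlas would yield infinitely many
    generators. Hence the number of colours has to be the same for all annuli.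

    The pieces are not G-stable, and u = w o F holds only on a piece. So w o F is divided on all of
    V, and the identity is then multiplied at gx by a smooth rho that is 1 on the piece and vanishes
    wherever u = w o F might fail. The factor rho(gx) belongs to the generator, which is evaluated
    at gx as well, while the coefficients remain functions of x. Functions s_j with sum_j rho_j s_j
    = 1 finally put the pieces together. *)

Section CkCalculus.
Context {R : realType} {n : nat}.
Implicit Types (k : nat) (U : set 'rV[R]_n).

Lemma Ck_on_leq {W : normedModType R} j k U (f : 'rV[R]_n -> W) :
  (j <= k)%N -> Ck_on k U f -> Ck_on j U f.
Proof.
move=> /subnK <-; elim: (k - j)%N => // i IH; rewrite addSn => /Ck_onW.
exact: IH.
Qed.

Lemma Ck_on_subset {W : normedModType R} k U U' (f : 'rV[R]_n -> W) :
  U' `<=` U -> Ck_on k U f -> Ck_on k U' f.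
Proof.
move=> sU; elim: k f => [|k IH] f /=; first by move=> cf x /sU; exact: cf.
by move=> [df Df]; split=> [x /sU /df//|v]; exact: IH.
Qed.

Lemma Ck_on_local {W : normedModType R} k U (f : 'rV[R]_n -> W) :
  (forall x, U x -> exists2 N, open N /\ N x & Ck_on k N f) -> Ck_on k U f.
Proof.
elim: k f => [|k IH] f /= H.
  by move=> x /H[N [_ Nx] cf]; exact: cf.
split=> [x /H[N [_ Nx] [df _]]|v]; first exact: df.
by apply: IH => x /H[N ON [_ Df]]; exists N.
Qed.

Lemma Ck_on_sum {W : normedModType R} k U (I : Type) (r : seq I) (P : pred I)
    (f : I -> 'rV[R]_n -> W) :
  open U -> (forall i, P i -> Ck_on k U (f i)) ->
  Ck_on k U (\sum_(i <- r | P i) f i).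
Proof.
move=> oU H; elim/big_ind: _ => //; first exact: Ck_on_cst.
by move=> g h; exact: Ck_onD.
Qed.

Lemma Ck_onZl {W : normedModType R} k U (f : 'rV[R]_n -> R) (w : W) :
  open U -> Ck_on k U f -> Ck_on k U (fun x => f x *: w).
Proof.
move=> oU; elim: k f => [|k IH] f /=.
  by move=> cf x Ux; apply: continuousZr_tmp; exact: cf.
move=> [df Df]; split=> [x Ux|v]; first by apply: differentiableZl; exact: df.
apply: Ck_on_eq oU _ (IH _ (Df v)) => x /set_mem Ux.
have dfx := df _ Ux.
by rewrite (deriveE _ (differentiableZl _ dfx)) diffZl// deriveE.
Qed.

Lemma Ck_on_linear {W : normedModType R} k U (f : {linear 'rV[R]_n -> W}) :
  continuous f -> Ck_on k U f.
Proof.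
move=> cf; case: k => [|k]; first by move=> x _; exact: cf.
split=> [x _|v]; first exact: linear_differentiable.
rewrite (_ : 'D_v f = cst (f v)); first exact: Ck_on_cst.
apply/funext => x; rewrite deriveE; last exact: linear_differentiable.
by rewrite diff_lin.
Qed.

Lemma Ck_on_proj k U (i : 'I_n) : Ck_on k U (fun x : 'rV[R]_n => x 0 i).
Proof.
case: k => [|k]; first by move=> x _; exact: coord_continuous.
split=> [x _|v]; first exact: differentiable_coord.
rewrite (_ : 'D_v _ = cst (v 0 i)); first exact: Ck_on_cst.
apply/funext => x.
have idv : derivable (@id 'rV[R]_n) x v by [].
have := derive_mx idv.
by rewrite derive_id => /matrixP/(_ 0 i); rewrite mxE.
Qed.

End CkCalculus.

Section Composition.
Context {R : realType}.

Lemma Ck_on_coord n m k (U : set 'rV[R]_n) (f : 'rV[R]_n -> 'rV[R]_m) i :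
  open U -> Ck_on k U f -> Ck_on k U (fun x => f x 0 i).
Proof.
move=> oU; elim: k f => [|k IH] f /=.
  move=> cf x Ux.
  by apply: (@continuous_comp _ _ _ f (fun y : 'rV[R]_m => y 0 i));
    [exact: cf|exact: coord_continuous].
move=> [df Df]; split=> [x Ux|v].
  apply: (@differentiable_comp _ _ _ _ f (fun y : 'rV[R]_m => y 0 i)).
    exact: df.
  exact: differentiable_coord.
apply: Ck_on_eq oU _ (IH _ (Df v)) => x /set_mem Ux.
by rewrite derive_mx ?mxE//; apply: diff_derivable; exact: df.
Qed.

Lemma row_sum_coord n m (f : 'rV[R]_n -> 'rV[R]_m) :
  f = \sum_i (fun x => f x 0 i *: delta_mx 0 i).
Proof. by apply/funext => x; rewrite fct_sumE -row_sum_delta. Qed.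

Lemma Ck_on_row n m k (U : set 'rV[R]_n) (f : 'rV[R]_n -> 'rV[R]_m) :
  open U -> (forall i, Ck_on k U (fun x => f x 0 i)) -> Ck_on k U f.
Proof.
move=> oU H; rewrite (row_sum_coord f); apply: Ck_on_sum => // i _.
exact: Ck_onZl.
Qed.

Lemma derive_sum_partial n (f : 'rV[R]_n -> R) x v : differentiable f x ->
  'D_v f x = \sum_i v 0 i * 'D_(delta_mx 0 i) f x.
Proof.
move=> df; rewrite deriveE// {1}(row_sum_delta v) linear_sum/=.
by apply: eq_bigr => i _; rewrite linearZ /= deriveE.
Qed.

Lemma Ck_on_comp n m k (U : set 'rV[R]_n) (O : set 'rV[R]_m)
    (g : 'rV[R]_n -> 'rV[R]_m) (f : 'rV[R]_m -> R) :
  open U -> (forall x, U x -> O (g x)) ->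
  Ck_on k U g -> Ck_on k O f -> Ck_on k U (f \o g).
Proof.
move=> oU UO; elim: k f => [|k IH] f.
  by move=> cg cf x Ux; apply: continuous_comp; [exact: cg|exact/cf/UO].
move=> Cg Cf; have [[dg Dg] [df Df]] := (Cg, Cf); split=> [x Ux|v].
  by apply: differentiable_comp; [exact: dg|exact/df/UO].
(* The derivative of [f] at [g x] is taken in the direction ['D_v g x], which moves with [x].
   Expanding it in the standard basis leaves only fixed directions, to which the induction
   hypothesis applies. *)
pose h := \sum_i ((fun x => 'D_v g x 0 i) * ('D_(delta_mx 0 i) f \o g)).
apply: (@Ck_on_eq _ _ _ _ _ h) => // [x /set_mem Ux|].
  rewrite deriveE; last by apply: differentiable_comp; [exact: dg|exact/df/UO].
  rewrite diff_comp; [|exact: dg|exact/df/UO].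
  rewrite /= -!deriveE; [|exact: dg|exact/df/UO].
  rewrite (derive_sum_partial _ (df _ (UO _ Ux))) /h fct_sumE.
  exact: eq_bigr.
apply: Ck_on_sum => // i _; apply: (Ck_onM oU).
  exact: (Ck_on_coord _ oU (Dg v)).
apply: IH (Df _); exact: Ck_onW.
Qed.

(* A class S closed under derivation replaces the tower of derivatives of f. *)
Lemma Ck_on_comp1 n k (U : set 'rV[R]_n) (S : set (R -> R))
    (g : 'rV[R]_n -> R) (f : R -> R) :
  (forall h, S h -> exists2 h', S h' & forall t : R, is_derive t 1 h (h' t)) ->
  open U -> S f -> Ck_on k U g -> Ck_on k U (f \o g).
Proof.
move=> HS oU; elim: k f => [|k IH] f Sf.
  move=> cg x Ux; apply: continuous_comp; first exact: cg.
  have [f' _ df] := HS _ Sf.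
  apply: differentiable_continuous; exact/derivable1_diffP.
move=> Cg; have [dg Dg] := Cg; have [f' Sf' df] := HS _ Sf.
have df1 t : differentiable f t by exact/derivable1_diffP.
split=> [x Ux|v].
  by apply: differentiable_comp; [exact: dg|exact: df1].
apply: (@Ck_on_eq _ _ _ _ _ ((f' \o g) * 'D_v g)) => // [x /set_mem Ux|].
  have dgx := dg _ Ux.
  rewrite (deriveE _ (differentiable_comp dgx (df1 _))) diff_comp//=.
  rewrite -(deriveE _ dgx) deriv1E; last by case: (df (g x)).
  have dfx := df (g x); by rewrite derive1E derive_val [RHS]mulrC.
exact: Ck_onM oU (IH _ Sf' (Ck_onW Cg)) (Dg v).
Qed.

End Composition.

(** * Integrals depending on a parameter *)

Section UnitIntegral.
Context {R : realType}.
Implicit Types g h : R -> R.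

Definition int01 g : R := \int[lebesgue_measure]_(s in `[0, 1]%classic) g s.

Lemma integrable01 g : continuous g ->
  lebesgue_measure.-integrable `[(0 : R), 1]%classic (EFin \o g).
Proof.
move=> cg; apply: continuous_compact_integrable; first exact: segment_compact.
exact: continuous_subspaceT.
Qed.

Lemma int01D g h : continuous g -> continuous h ->
  int01 (fun s => g s + h s) = int01 g + int01 h.
Proof. by move=> cg ch; apply: RintegralD => //; exact: integrable01. Qed.

Lemma int01Z (a : R) g : continuous g -> int01 (fun s => a * g s) = a * int01 g.
Proof. by move=> cg; apply: RintegralZl => //; exact: integrable01. Qed.

Lemma int01B g h : continuous g -> continuous h ->
  int01 (fun s => g s - h s) = int01 g - int01 h.
Proof. by move=> cg ch; apply: RintegralB => //; exact: integrable01. Qed.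

Lemma int01_bound g (e : R) : continuous g ->
  (forall s : R, s \in `[0, 1] -> `|g s| <= e) -> `|int01 g| <= e.
Proof.
move=> cg ge; apply: le_trans (le_normr_Rintegral _ (integrable01 cg)) _ => //.
have cn : continuous (fun s => `|g s|).
  by move=> s; apply: continuous_comp (cg s) (@norm_continuous _ _ _).
have ce : continuous (cst e : R -> R) by move=> s; exact: cst_continuous.
apply: le_trans (le_Rintegral _ (integrable01 cn) (integrable01 ce) _) _ => //.
rewrite Rintegral_cst//= lebesgue_measure_itv/= lte_fin ltr01 /=.
by rewrite subr0 mulr1.
Qed.

Lemma int01_FTC g G : continuous g -> (forall t : R, is_derive t 1 G (g t)) ->
  int01 g = G 1 - G 0.
Proof.
move=> cg dG; have cG : continuous G.
  by move=> t; apply/differentiable_continuous/derivable1_diffP.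
rewrite /int01 /Rintegral (@continuous_FTC2 _ g G)//.
- exact: continuous_subspaceT.
- split=> [t _||]; first by have [] := dG t.
  + exact/cvg_at_right_filter/cG.
  + exact/cvg_at_left_filter/cG.
- by move=> t _; rewrite derive1E; apply: derive_val.
Qed.

End UnitIntegral.

Lemma differentiable_estimate (R : realType) (V W : normedModType R)
    (f : V -> W) (df : {linear V -> W}) x : continuous df ->
  (forall e, 0 < e ->
    \forall h \near (0 : V), `|f (h + x) - f x - df h| <= e * `|h|) ->
  differentiable f x /\ 'd f x = df :> (V -> W).
Proof.
move=> cdf H; have fE : f \o shift x = cst (f x) + df +o_ 0 id.
  apply/eqaddoP => e e0; near=> h.
  have -> : (f \o shift x - (cst (f x) + df)) h = f (h + x) - f x - df h.
    by rewrite -addrA -opprD.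
  by near: h; exact: H.
have dE := diff_unique cdf fE.
by split=> //; apply/diff_locallyP; rewrite dE.
Unshelve. all: by end_near. Qed.

Section StrictDifferentiability.
Context {R : realType} {n : nat}.
Implicit Types f : 'rV[R]_n -> R.

Lemma is_derive_line f (y h : 'rV[R]_n) (t : R) :
  differentiable f (y + t *: h) ->
  is_derive t 1 (fun t => f (y + t *: h)) ('D_h f (y + t *: h)).
Proof.
move=> df; have dl : is_diff t (fun t : R => y + t *: h) (fun s => s *: h).
  have := is_diffD (is_diff_cst y t) (is_diff_scalel t h).
  by rewrite add0r.
have dfl : differentiable (f \o (fun t : R => y + t *: h)) t.
  by apply: differentiable_comp.
have := derivableP (@diff_derivable _ _ _ _ _ (1 : R) dfl).
rewrite (deriveE _ dfl) diff_comp// /= (@diff_val _ _ _ _ _ _ _ dl).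
by rewrite scale1r -deriveE.
Qed.

Lemma partial_bound f (v : 'rV[R]_n) x y e :
  differentiable f x -> differentiable f y ->
  (forall i, `|'D_(delta_mx 0 i) f x - 'D_(delta_mx 0 i) f y| <= e) ->
  `|'D_v f x - 'D_v f y| <= e *+ n * `|v|.
Proof.
move=> dfx dfy H; rewrite !derive_sum_partial// -sumrB.
under eq_bigr do rewrite -mulrBr.
apply: le_trans (ler_norm_sum _ _ _) _.
apply: (@le_trans _ _ (\sum_(i < n) (e * `|v|))); last first.
  by rewrite sumr_const card_ord mulrnAl.
apply: ler_sum => i _; rewrite normrM mulrC; apply: ler_pM => //.
rewrite [leRHS]/Num.Def.normr/= mx_normrE.
exact: (le_bigmax _ (fun k => `|v k.1 k.2|) (0, i)).
Qed.

(** The mean value theorem on the segment from [y] to [y + h], together with continuity of the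
    partial derivatives at [y0]. Uniformity in the base point [y] is what later lets the remainder
    be integrated along a path. *)
Lemma strict_differentiable f (y0 : 'rV[R]_n) (e : R) : 0 < e -> Ck_on 1 setT f ->
  \forall y \near y0 & h \near nbhs (0 : 'rV[R]_n),
    `|f (y + h) - f y - 'D_h f y| <= e * `|h|.
Proof.
move=> e0 [df cf]; have {}df x : differentiable f x by exact: df.
(* Two comparisons through [y0] in each of [n] coordinates cost [2 n d]; the extra 1 keeps the
   denominator positive for [n = 0]. *)
pose d := e / n.*2.+1%:R.
have d0 : 0 < d by rewrite divr_gt0.
have H i : \forall y \near y0,
    `|'D_(delta_mx 0 i) f y0 - 'D_(delta_mx 0 i) f y| <= d.
  exact: ((cvgrPdist_le _ _).1 (cf (delta_mx 0 i) y0 I) d d0).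
have [r /= r0 Hr] := (nbhs_ballP y0 _).1 (filter_forall _ H).
near=> y h.
have line t : 0 <= t <= 1 -> ball y0 r (y + t *: h).
  move=> /andP[t0 t1]; rewrite -ball_normE /= opprD addrA.
  apply: le_lt_trans (ler_normB _ _) _.
  rewrite (splitr r); apply: ltrD.
    have : ball y0 (r / 2) y by near: y; apply: nbhsx_ballx; rewrite divr_gt0.
    by rewrite -ball_normE.
  rewrite normrZ ger0_norm//; apply: le_lt_trans (_ : `|h| < _).
    by rewrite ler_piMl.
  have : ball (0 : 'rV[R]_n) (r / 2) h.
    by near: h; apply: nbhsx_ballx; rewrite divr_gt0.
  by rewrite -ball_normE /= sub0r normrN.
have [| |c] := @MVT R (fun t : R => f (y + t *: h))
  (fun t => 'D_h f (y + t *: h)) 0 1 ltr01.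
- by move=> t _; exact: is_derive_line.
- apply: continuous_subspaceT => t; apply: differentiable_continuous.
  by apply/derivable1_diffP; have [] := is_derive_line (df (y + t *: h)).
rewrite in_itv /= => /andP[c0 c1]; rewrite scale1r scale0r addr0 subr0 mulr1 => ->.
apply: (@le_trans _ _ ((d + d) *+ n * `|h|)).
  apply: partial_bound => // i.
  have H1 := Hr _ (line c _) i; have H0 := Hr _ (line 0 _) i.
  rewrite scale0r addr0 in H0.
  rewrite -(subrKA ('D_(delta_mx 0 i) f y0)) addrC.
  apply: le_trans (ler_normD _ _) _; apply: lerD.
    by apply: H0; rewrite lexx ler01.
  by rewrite distrC H1// !ltW.
apply: ler_wpM2r => //; rewrite -mulr2n -mulrnA mul2n -mulr_natr /d.
rewrite -mulrA; apply: ler_piMr; first exact: ltW.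
rewrite ler_pdivrMl// mulr1 ler_nat.
exact: leqnSn.
Unshelve. all: by end_near. Qed.

End StrictDifferentiability.

Section PathIntegral.
Context {R : realType} {n : nat}.
Variables L0 L1 : {linear 'rV[R]_n -> 'rV[R]_n}.
Hypotheses (cL0 : continuous L0) (cL1 : continuous L1).
Implicit Types f : 'rV[R]_n -> R.

Let path (s : R) x := L0 x + s *: L1 x.

(* The weights s ^+ k make the family closed under directional derivatives. *)
Definition path_int k f x : R := int01 (fun s => s ^+ k * f (path s x)).

Lemma path_continuous : continuous (fun p : R * 'rV[R]_n => path p.1 p.2).
Proof.
move=> p; apply: cvgD.
  by apply: (@continuous_comp _ _ _ snd L0); [exact: cvg_snd|exact: cL0].
apply: cvgZ; first exact: cvg_fst.
by apply: (@continuous_comp _ _ _ snd L1); [exact: cvg_snd|exact: cL1].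
Qed.

Lemma weight_path_continuous k f : continuous f ->
  continuous (fun p : R * 'rV[R]_n => p.1 ^+ k * f (path p.1 p.2)).
Proof.
move=> cf p; apply: cvgM.
  apply: (@continuous_comp _ _ _ fst (fun s : R => s ^+ k)); first exact: cvg_fst.
  exact: exprn_continuous.
apply: (@continuous_comp _ _ _ (fun p : R * 'rV[R]_n => path p.1 p.2) f).
  exact: path_continuous.
exact: cf.
Qed.

Lemma path_int_continuous_arg k f x : continuous f ->
  continuous (fun s : R => s ^+ k * f (path s x)).
Proof.
move=> cf s; apply: cvgM; first exact: exprn_continuous.
apply: (@continuous_comp _ _ _ (path ^~ x) f); last exact: cf.
by apply: cvgD; [exact: cvg_cst|apply: cvgZ; [exact: cvg_id|exact: cvg_cst]].
Qed.

(** Compactness of [0, 1], in near-covering form, turns joint continuity of the integrand into a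
    bound valid for all [s] at once. *)
Lemma path_int_continuous k f : continuous f -> continuous (path_int k f).
Proof.
move=> cf x; apply/(@cvgrPdist_le _ _ _ (nbhs x)) => e e0.
have e20 : 0 < e / 2 by rewrite divr_gt0.
have cov := (compact_near_coveringP `[0 : R, 1]%classic).1 (@segment_compact R 0 1).
have := cov _ (nbhs x) (fun y s =>
  `|s ^+ k * f (path s x) - s ^+ k * f (path s y)| <= e) (nbhs_filter x).
move=> H; near=> y.
have H' : `[0 : R, 1] `<=` (fun s =>
   `|s ^+ k * f (path s x) - s ^+ k * f (path s y)| <= e).
  near: y; apply: H => s _.
  have := (cvgrPdist_le _ _).1 (@weight_path_continuous k f cf (s, x)) _ e20.
  move=> H2; rewrite near_simpl /= in H2; case: H2 => -[A B] /= [As Bx] AB.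
  exists (A, B) => //= -[t y'] /= [At By'].
  have H1 := AB (t, x) (conj At (nbhs_singleton Bx)).
  have H2 := AB (t, y') (conj At By').
  rewrite -(subrKA (s ^+ k * f (path s x))) (splitr e).
  apply: le_trans (ler_normD _ _) _; apply: lerD => //.
  by rewrite distrC.
rewrite -int01B; [|exact: path_int_continuous_arg..].
apply: int01_bound.
  by move=> s; apply: cvgB; exact: path_int_continuous_arg.
by move=> s s01; exact: H'.
Unshelve. all: by end_near. Qed.

(** Differentiation under the integral sign. The integrand has derivative
    [s ^+ k * 'D_(path s v) f (path s x)] along [v]; since [path s v = L0 v + s *: L1 v], it splits
    into two terms, the second with the exponent raised by one. *)
Lemma path_int_differentiable k f x : Ck_on 1 setT f ->
  differentiable (path_int k f) x /\ forall v, 'D_v (path_int k f) x =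
    path_int k ('D_(L0 v) f) x + path_int k.+1 ('D_(L1 v) f) x.
Proof.
move=> Cf; have [df cDf] := Cf.
have {}df y : differentiable f y by exact: df.
have {}cDf v : continuous ('D_v f) by move=> y; exact: cDf.
have cf : continuous f by move=> y; exact: differentiable_continuous.
have ca j u := @path_int_continuous_arg j _ x (cDf u).
pose D v := path_int k ('D_(L0 v) f) x + path_int k.+1 ('D_(L1 v) f) x.
have pE v (s : R) : s ^+ k * 'D_(path s v) f (path s x) =
    s ^+ k * 'D_(L0 v) f (path s x) + s ^+ k.+1 * 'D_(L1 v) f (path s x).
  rewrite !deriveE// /path linearD linearZ /= exprSr mulrDr; congr (_ + _).
  exact: mulrA.
have DE v : D v = int01 (fun s => s ^+ k * 'D_(path s v) f (path s x)).
  rewrite /D /path_int -int01D; [|exact: ca..].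
  by congr int01; apply/funext => s; rewrite pE.
have cD (v : 'rV[R]_n) :
    continuous (fun s : R => s ^+ k * 'D_(path s v) f (path s x)).
  rewrite (funext (pE v)) => s.
  by apply: cvgD; exact: ca.
have Dlin : linear D.
  move=> a u v.
  have caD : continuous (fun s : R => a * (s ^+ k * 'D_(path s u) f (path s x))).
    by move=> s; apply: cvgM; [exact: cvg_cst|exact: cD].
  rewrite !DE -[_ *: int01 _]/(a * int01 _) -(int01Z a (cD u)) -(int01D caD (cD v)).
  congr int01; apply/funext => s.
  have -> : path s (a *: u + v) = a *: path s u + path s v.
    by rewrite /path !linearP /= !scalerDr !scalerA addrACA.
  rewrite !deriveE// linearP /= mulrDr; congr (_ + _).
  exact: mulrCA.
pose Dm := GRing.isLinear.Build _ _ _ _ _ Dlin.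
pose DL : {linear 'rV[R]_n -> R} := HB.pack D Dm.
have cDL : continuous DL.
  have -> : (DL : 'rV[R]_n -> R) =
      \sum_i (fun v : 'rV[R]_n => v 0 i *: DL (delta_mx 0 i)).
    apply/funext => v; rewrite fct_sumE {1}(row_sum_delta v) linear_sum.
    by apply: eq_bigr => i _; rewrite linearZ.
  suff H : Ck_on 0 setT (\sum_i (fun v : 'rV[R]_n => v 0 i *: DL (delta_mx 0 i))).
    by move=> v; exact: (H v I).
  apply: Ck_on_sum; first exact: openT.
  by move=> i _; apply: Ck_onZl; [exact: openT|exact: Ck_on_proj].
suff [dJ dJE] : differentiable (path_int k f) x /\
    'd (path_int k f) x = DL :> (_ -> _).
  by split=> // v; rewrite deriveE// dJE.
apply: differentiable_estimate => // e e0.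
have [C0 C0p HC0] := linear_lipschitz cL0.
have [C1 C1p HC1] := linear_lipschitz cL1.
have Cp : 0 < C0 + C1 by rewrite addr_gt0.
have pathC (s : R) v : s \in `[0, 1] -> `|path s v| <= (C0 + C1) * `|v|.
  rewrite in_itv /= => /andP[s0 s1]; apply: le_trans (ler_normD _ _) _.
  rewrite mulrDl; apply: lerD => //; rewrite normrZ ger0_norm//.
  by apply: le_trans (HC1 v); rewrite ler_piMl.
(* Strict differentiability is applied to the increment [path s h], whose norm is at most
   [(C0 + C1) * |h|]; the quotient compensates for this factor. *)
have e'0 : 0 < e / (C0 + C1) by rewrite divr_gt0.
have cov := (compact_near_coveringP `[0 : R, 1]%classic).1 (@segment_compact R 0 1).
have H := cov _ (nbhs (0 : 'rV[R]_n)) (fun h s =>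
  `|f (path s x + path s h) - f (path s x) - 'D_(path s h) f (path s x)| <=
    e / (C0 + C1) * `|path s h|) (nbhs_filter (0 : 'rV[R]_n)).
near=> h.
have H' : `[0 : R, 1] `<=` (fun s =>
  `|f (path s x + path s h) - f (path s x) - 'D_(path s h) f (path s x)| <=
    e / (C0 + C1) * `|path s h|).
  near: h; apply: H => s _.
  have [[A B] /= [Ax B0] AB] := strict_differentiable (path s x) e'0 Cf.
  have A' : \forall t \near s, A (path t x).
    have : path^~ x @ s --> path s x.
      by apply: cvgD; [exact: cvg_cst|apply: cvgZ; [exact: cvg_id|exact: cvg_cst]].
    exact.
  have B' : \forall p \near (s, (0 : 'rV[R]_n)), B (path p.1 p.2).
    apply: (@path_continuous (s, 0)) => /=.
    by rewrite /path !linear0 addr0.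
  case: B' => -[A2 B2] /= [A2s B20] AB2.
  exists (A2 `&` (fun t => A (path t x)), B2) => /=.
    by split => //; apply: filterI.
  move=> -[t u] /= [[A2t At] B2u].
  by apply: (AB (path t x, path t u)); split => //; apply: (AB2 (t, u)).
rewrite /DL /= DE.
rewrite -int01B; [|exact: path_int_continuous_arg..].
rewrite -int01B//; last first.
  by move=> s; apply: cvgB; exact: path_int_continuous_arg.
apply: int01_bound.
  move=> s; apply: cvgB; last exact: cD.
  by apply: cvgB; exact: path_int_continuous_arg.
move=> s s01; rewrite -!mulrBr normrM.
have -> : path s (h + x) = path s x + path s h.
  by rewrite /path !linearD /= addrACA addrC.
have := H' s s01 => Hs.
apply: (@le_trans _ _ (1 * (e / (C0 + C1) * `|path s h|))).
  apply: ler_pM => //; move: s01; rewrite in_itv /= => /andP[s0 s1].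
  by rewrite normrX ger0_norm// exprn_ile1.
rewrite mul1r mulrAC ler_pdivrMr// -mulrA; apply: ler_wpM2l; first exact: ltW.
by rewrite mulrC; exact: pathC.
Unshelve. all: by end_near. Qed.

Lemma path_int_Ck j k f : Ck_on j setT f -> Ck_on j setT (path_int k f).
Proof.
elim: j k f => [|j IH] k f Cf.
  by move=> x _; apply: path_int_continuous => y; exact: Cf.
have C1f : Ck_on 1 setT f by exact: Ck_on_leq Cf.
split=> [x _|v]; first exact: (path_int_differentiable _ _ C1f).1.
rewrite (_ : 'D_v _ = path_int k ('D_(L0 v) f) + path_int k.+1 ('D_(L1 v) f)).
  by case: Cf => _ Df; exact: Ck_onD openT (IH _ _ (Df _)) (IH _ _ (Df _)).
by apply/funext => x; rewrite (path_int_differentiable _ _ C1f).2.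
Qed.

End PathIntegral.

(** * Newton interpolation *)

Section Interpolation.
Context {R : realType} {n : nat}.
Implicit Types (f : 'rV[R]_n -> R) (P : {set 'I_n}).

(** [P] collects the coordinates already divided out. Once it contains all variables, the
    coefficients depend on the nodes only. *)
Definition indep P f :=
  forall z z' : 'rV[R]_n, (forall j, j \notin P -> z 0 j = z' 0 j) -> f z = f z'.

Definition subst_coord (i k : 'I_n) (z : 'rV[R]_n) : 'rV[R]_n :=
  \row_j if j == i then z 0 k else z 0 j.

(** [subst_coord i k z + s *: coord_diff i k z] runs from the substituted point ([s = 0]) to [z]
    ([s = 1]), moving only coordinate [i], from the node [z 0 k] to [z 0 i]. *)
Definition coord_diff (i k : 'I_n) (z : 'rV[R]_n) : 'rV[R]_n :=
  (z 0 i - z 0 k) *: delta_mx 0 i.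

Fact subst_coord_linear i k : linear (subst_coord i k).
Proof. by move=> a u v; apply/rowP => j; rewrite !mxE; case: ifP. Qed.
HB.instance Definition _ i k :=
  GRing.isLinear.Build R _ _ _ (subst_coord i k) (subst_coord_linear i k).

Fact coord_diff_linear i k : linear (coord_diff i k).
Proof. by move=> a u v; apply/rowP => j; rewrite !mxE; ring. Qed.
HB.instance Definition _ i k :=
  GRing.isLinear.Build R _ _ _ (coord_diff i k) (coord_diff_linear i k).

Lemma continuous_row m (g : 'rV[R]_n -> 'rV[R]_m) :
  (forall i, continuous (fun x => g x 0 i)) -> continuous g.
Proof.
move=> H x.
by apply: (@Ck_on_row R n m 0 setT g openT) => // i y _; exact: H.
Qed.

Lemma subst_coord_continuous i k : continuous (subst_coord i k).
Proof.
apply: continuous_row => j.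
rewrite (_ : (fun _ => _) = (fun z : 'rV[R]_n => z 0 (if j == i then k else j))).
  exact: coord_continuous.
by apply/funext => z; rewrite mxE; case: ifP.
Qed.

Lemma coord_diff_continuous i k : continuous (coord_diff i k).
Proof.
suff H : Ck_on 0 setT (coord_diff i k) by move=> z; exact: (H z I).
have p j : Ck_on 0 setT (fun z : 'rV[R]_n => z 0 j) by exact: Ck_on_proj.
exact/Ck_onZl/(Ck_onD openT (p i) (Ck_onN openT (p k)))/openT.
Qed.

Lemma indep_derive P f v : indep P f -> indep P ('D_v f).
Proof.
move=> iP z z' zz'; rewrite /derive.
rewrite (_ : (fun h => h^-1 *: ((f \o shift z) (h *: v) - f z)) =
  (fun h => h^-1 *: ((f \o shift z') (h *: v) - f z')))//.
apply/funext => h /=; rewrite (iP _ _ zz') (iP (h *: v + z) (h *: v + z'))//.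
by move=> j jP; rewrite !mxE zz'.
Qed.

(** [Q] is the integral over [0, 1] of the [i]-th partial derivative along that segment: the first
    divided difference of [f], with the node as one more coordinate. It is therefore jointly smooth
    in variable and node, also where they coincide. *)
Lemma hadamard i k P f : k \notin P -> smooth_on setT f -> indep P f ->
  exists Q, [/\ smooth_on setT Q, indep P Q &
    forall z, f z = f (subst_coord i k z) + (z 0 i - z 0 k) * Q z].
Proof.
move=> kP sf iP; pose L0 := subst_coord i k; pose L1 := coord_diff i k.
have cf : continuous ('D_(delta_mx 0 i) f).
  by move=> x; exact: ((sf 1).2 _ x I).
exists (path_int L0 L1 0 ('D_(delta_mx 0 i) f)); split.
- move=> j; apply: path_int_Ck; first exact: subst_coord_continuous.
    exact: coord_diff_continuous.
  exact: (sf j.+1).2.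
- move=> z z' zz'; rewrite /path_int; congr int01; apply/funext => s.
  congr (_ * _); apply: indep_derive iP _ _ _ => j jP; rewrite !mxE.
  case: eqP => [ji|_]; first by rewrite -ji !zz'.
  by rewrite /= !mulr0 zz'.
- move=> z; have cD := @path_int_continuous_arg _ _ L0 L1 0 _ z cf.
  rewrite /path_int -(int01Z _ cD).
  have cD' : continuous (fun s : R => (z 0 i - z 0 k) *
      (s ^+ 0 * 'D_(delta_mx 0 i) f (L0 z + s *: L1 z))).
    by move=> s; apply: cvgM; [exact: cvg_cst|exact: cD].
  have ds y : differentiable f y by exact: (sf 1).1.
  have dG (s : R) : is_derive s 1 (fun s : R => f (L0 z + s *: L1 z))
      ((z 0 i - z 0 k) * (s ^+ 0 * 'D_(delta_mx 0 i) f (L0 z + s *: L1 z))).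
    rewrite expr0 mul1r (_ : _ * _ = 'D_(L1 z) f (L0 z + s *: L1 z)).
      exact: is_derive_line.
    by rewrite !deriveE// [in RHS]/L1 /coord_diff [RHS]linearZ.
  rewrite (int01_FTC cD' dG) scale1r scale0r addr0 addrC subrK; congr f.
  apply/rowP => j; rewrite !mxE /=; case: eqP => [->|_].
    by rewrite mulr1 addrC subrK.
  by rewrite mulr0 addr0.
Qed.

(** Induction on the nodes through [f z = f0 z + (z 0 i - z 0 k) * Q z]. If [z 0 i] is the node
    [z 0 k], the second term vanishes whatever [Q] is; otherwise [z 0 i] is one of the remaining
    nodes, and the induction hypothesis expands [Q]. *)
Lemma newton i (s : seq 'I_n) P f : smooth_on setT f -> indep P f ->
  {in s, forall k, k \notin i |: P} ->
  exists a : nat -> 'rV[R]_n -> R,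
    (forall j, smooth_on setT (a j) /\ indep (i |: P) (a j)) /\
    forall z : 'rV[R]_n, has (fun k => z 0 i == z 0 k) s ->
      f z = \sum_(j < size s) a j z * z 0 i ^+ j.
Proof.
elim: s f => [|k s IH] f sf iP sP.
  exists (fun _ => cst 0); split=> // j; split=> // l; exact: Ck_on_cst.
have kiP : k \notin i |: P by rewrite sP// mem_head.
move: (kiP); rewrite in_setU1 negb_or => /andP[ki kP].
have [Q [sQ iQ fQ]] := hadamard i kP sf iP.
have [|a [Ha fa]] := IH _ sQ iQ; first by move=> l ls; rewrite sP// in_cons ls orbT.
pose f0 := f \o subst_coord i k.
have sf0 : smooth_on setT f0.
  move=> l; apply: (Ck_on_comp openT _ _ (sf l)) => //.
  exact/Ck_on_linear/subst_coord_continuous.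
have if0 : indep (i |: P) f0.
  move=> z z' zz'; apply: iP => j jP; rewrite !mxE.
  by case: eqP => ji; apply: zz' => //; rewrite in_setU1 negb_or jP andbT; apply/eqP.
(* Multiplying [\sum_j a j z * z 0 i ^+ j] by [z 0 i - z 0 k] gives coefficients
   [a (j - 1) - z 0 k * a j]: [a1] is the shift, with [f0] in degree 0, and [a0] cuts [a] off beyond
   its degree. *)
pose a0 j := if (j < size s)%N then a j else cst 0.
have sa0 j : smooth_on setT (a0 j) /\ indep (i |: P) (a0 j).
  rewrite /a0; case: ifP => _; first exact: Ha.
  by split=> // l; exact: Ck_on_cst.
pose a1 j := (if j is j'.+1 then a j' else f0).
have sa1 j : smooth_on setT (a1 j) /\ indep (i |: P) (a1 j).
  by case: j => [|j]; [split|exact: Ha].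
exists (fun j => a1 j - (fun z : 'rV[R]_n => z 0 k) * a0 j); split.
  move=> j; split.
    move=> l; apply: Ck_onD; [exact: openT|exact: (sa1 j).1|].
    apply: Ck_onN; first exact: openT.
    apply: Ck_onM; [exact: openT|exact: Ck_on_proj|exact: (sa0 j).1].
  move=> z z' zz'; rewrite !fctE /= ((sa1 j).2 _ _ zz') ((sa0 j).2 _ _ zz').
  by rewrite zz'.
move=> z hz.
have -> : \sum_(j < size (k :: s))
      (a1 j - (fun z : 'rV[R]_n => z 0 k) * a0 j) z * z 0 i ^+ j =
    f0 z + (z 0 i - z 0 k) * \sum_(j < size s) a j z * z 0 i ^+ j.
  under eq_bigr do rewrite !fctE /= mulrBl.
  rewrite sumrB big_ord_recl /= expr0 mulr1 [in X in _ - X]big_ord_recr /=.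
  rewrite /a0 ltnn /= mulr0 mul0r addr0 mulrBl -addrA; congr (_ + _); congr (_ - _).
    rewrite mulr_sumr; apply: eq_bigr => j _.
    by rewrite /= /bump /= add1n exprS mulrCA.
  rewrite mulr_sumr; apply: eq_bigr => j _.
  by rewrite ltn_ord mulrA.
rewrite fQ; congr (_ + _).
move: hz => /= /orP[/eqP ->|hz]; first by rewrite subrr !mul0r.
by rewrite fa.
Qed.

(* v.1 is a variable and v.2 the list of the nodes of that variable. *)
Lemma multi_newton (vs : seq ('I_n * seq 'I_n)) (Y : {set 'I_n}) :
  (forall v, v \in vs -> v.1 \in Y) ->
  (forall v k, v \in vs -> k \in v.2 -> k \notin Y) ->
  exists (T : finType) (e : T -> 'rV[R]_n -> R),
    (forall t, smooth_on setT (e t) /\ indep (~: Y) (e t)) /\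
    forall P f, P \subset Y -> smooth_on setT f -> indep P f ->
    exists a : T -> 'rV[R]_n -> R,
      (forall t, smooth_on setT (a t) /\
         indep (P :|: [set i in unzip1 vs]) (a t)) /\
      forall z : 'rV[R]_n,
        (forall v, v \in vs -> has (fun k => z 0 v.1 == z 0 k) v.2) ->
      f z = \sum_t a t z * e t z.
Proof.
elim: vs => [|[i s] vs IH] vY sY.
  exists 'I_1, (fun _ => cst 1); split.
    by move=> t; split=> // l; exact: Ck_on_cst.
  move=> P f PY sf iP; exists (fun _ => f); split.
    move=> t; split=> // z z' zz'; apply: iP => j jP; apply: zz'.
    by rewrite !inE negb_or jP.
  by move=> z _; rewrite big_ord1 mulr1.
have [||T [e [He H]]] := IH.
- by move=> v vvs; apply: vY; rewrite in_cons vvs orbT.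
- by move=> v k vvs; apply: sY; rewrite in_cons vvs orbT.
have iY : i \in Y by apply: (vY (i, s)); rewrite mem_head.
(* The monomials with exponent of [z 0 i] below the number of its nodes, chosen before [f] is
   given. *)
exists ('I_(size s) * T)%type, (fun jt : 'I_(size s) * T =>
    (fun z : 'rV[R]_n => z 0 i ^+ jt.1) * e jt.2); split.
  move=> [j t]; split=> /=.
    move=> l; apply: Ck_onM; [exact: openT| |exact: (He t).1].
    rewrite (_ : (fun _ => _) = (fun z : 'rV[R]_n => z 0 i) ^+ j); last first.
      by apply/funext => z; rewrite fctE.
    elim: (nat_of_ord j) => [|m IHm]; first exact: Ck_on_cst.
    rewrite exprS; apply: Ck_onM => //; [exact: openT|exact: Ck_on_proj].
  move=> z z' zz'; rewrite !fctE /= ((He t).2 _ _ zz') zz'//.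
  by rewrite !inE iY.
move=> P f PY sf iP.
have [|a [Ha fa]] := newton sf iP (s := s) (i := i).
  move=> k ks; have kY := sY (i, s) k (mem_head _ _) ks.
  rewrite in_setU1 negb_or; apply/andP; split.
    by apply: contraNneq kY => ->.
  by apply: contra kY => /(fintype.subsetP PY).
have PY' : i |: P \subset Y by rewrite finset.subUset finset.sub1set iY.
(* Each coefficient for the first variable is itself divided with respect to the remaining ones; it
   already ignores coordinate [i], and the enlarged set [i |: P] remembers this. *)
have /choice[b Hb] j := H _ _ PY' (Ha j).1 (Ha j).2.
exists (fun jt : 'I_(size s) * T => b jt.1 jt.2); split.
  move=> [j t]; have [Hbj _] := Hb j; split; first exact: (Hbj t).1.
  move=> z z' zz'; apply: (Hbj t).2 => l lP; apply: zz'.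
  apply: contra lP; rewrite !inE /= -/(unzip1 vs).
  by case/or3P => -> //; rewrite orbT.
move=> z Hz; rewrite fa; last by apply: (Hz (i, s)); rewrite mem_head.
rewrite (eq_bigr (fun j : 'I_(size s) => \sum_t b j t z * (z 0 i ^+ j * e t z))).
  by rewrite pair_big /=.
move=> j _; have [_ ->] := Hb j.
  rewrite mulr_suml; apply: eq_bigr => t _.
  by rewrite [in RHS]mulrCA mulrC.
by move=> v vvs; apply: Hz; rewrite in_cons vvs orbT.
Qed.

End Interpolation.

(** * Smooth functions on a manifold *)

Section Charts.
Context {R : realType} {n : nat} {M : manifold R n}.
Implicit Types c d : chart R n M.

Lemma chart_map_at c x : chart_dom c x -> {for x, continuous (chart_map c)}.
Proof.
move=> cx.
have := @chart_map_continuous _ _ _ c; rewrite continuous_open_subspace; last first.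
  exact: chart_dom_open.
by apply; rewrite inE.
Qed.

Lemma chart_inv_at c y : (chart_map c @` chart_dom c) y ->
  {for y, continuous (chart_inv c)}.
Proof.
move=> cy.
have := @chart_inv_continuous _ _ _ c; rewrite continuous_open_subspace; last first.
  exact: chart_img_open.
by apply; rewrite inE.
Qed.

Lemma chart_invP c y : (chart_map c @` chart_dom c) y ->
  chart_dom c (chart_inv c y) /\ chart_map c (chart_inv c y) = y.
Proof. by move=> [x cx <-]; rewrite chart_mapK. Qed.

Lemma chart_image_open c (W : set M) : open W -> W `<=` chart_dom c ->
  open (chart_map c @` W).
Proof.
move=> oW Wc.
rewrite (_ : _ @` W = (chart_map c @` chart_dom c) `&` chart_inv c @^-1` W).
  rewrite openE => y [cy Wy]; apply: filterI.
    by apply: open_nbhs_nbhs; split => //; exact: chart_img_open.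
  apply: (chart_inv_at cy); exact: open_nbhs_nbhs.
apply/seteqP; split => [_ [x Wx <-]|y [[x cx <-]]].
  by split; [exists x => //; exact: Wc|rewrite /= chart_mapK//; exact: Wc].
by rewrite /= chart_mapK// => Wx; exists x.
Qed.

Lemma transition_smooth c d : atlas c -> atlas d ->
  smooth_on (chart_map c @` (chart_dom c `&` chart_dom d))
    (chart_map d \o chart_inv c).
Proof. exact: (atlasP M).2. Qed.

(** One chart around each point is enough: transition maps carry smoothness to every other chart. *)
Lemma smooth_real_local (f : M -> R) :
  (forall x, exists (c : chart R n M) (W : set M),
    [/\ atlas c, open W, W x, W `<=` chart_dom c &
     smooth_on (chart_map c @` W) (f \o chart_inv c)]) -> smooth_real f.
Proof.
move=> H d Ad k; apply: Ck_on_local => _ [x dx <-].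
have [c [W [Ac oW Wx Wc sf]]] := H x.
exists (chart_map d @` (W `&` chart_dom d)).
  split; last by exists x.
  apply: chart_image_open; first exact: openI (chart_dom_open _).
  by move=> y [].
apply: (@Ck_on_eq _ _ _ _ _ ((f \o chart_inv c) \o (chart_map c \o chart_inv d))).
- apply: chart_image_open; first exact: openI (chart_dom_open _).
  by move=> y [].
- move=> y /set_mem[z [Wz dz] <-] /=.
  by rewrite !chart_mapK//; exact: Wc.
apply: (@Ck_on_comp _ _ _ _ _ (chart_map c @` W)); last exact: sf.
- apply: chart_image_open; first exact: openI (chart_dom_open _).
  by move=> y [].
- by move=> _ [z [Wz dz] <-] /=; rewrite chart_mapK//; exists z.
apply: Ck_on_subset (transition_smooth Ad Ac k) => _ [z [Wz dz] <-].
by exists z => //; split => //; exact: Wc.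
Qed.

Lemma smooth_real_row m (F : M -> 'rV[R]_m) c k :
  (forall i, smooth_real (fun x => F x 0 i)) -> atlas c ->
  Ck_on k (chart_map c @` chart_dom c) (F \o chart_inv c).
Proof.
move=> sF Ac; apply: Ck_on_row; first exact: chart_img_open.
by move=> i; exact: sF.
Qed.

Lemma smooth_real_comp m (F : M -> 'rV[R]_m) (f : 'rV[R]_m -> R) :
  (forall i, smooth_real (fun x => F x 0 i)) -> smooth_on setT f ->
  smooth_real (f \o F).
Proof.
move=> sF sf c Ac k.
apply: (@Ck_on_comp _ _ _ _ _ setT (F \o chart_inv c)) => //.
- exact: chart_img_open.
- exact: smooth_real_row.
Qed.

Lemma smooth_real_pull (F : M -> M) (f : M -> R) :
  smooth_map F -> smooth_real f -> smooth_real (f \o F).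
Proof.
move=> [cF sF] sf; apply: smooth_real_local => x.
have [c Ac cx] := (atlasP M).1 x; have [d Ad dx] := (atlasP M).1 (F x).
have oW : open (chart_dom c `&` F @^-1` chart_dom d).
  apply: openI; first exact: chart_dom_open.
  by apply: open_comp; [move=> y _; exact: cF|exact: chart_dom_open].
exists c, (chart_dom c `&` F @^-1` chart_dom d); split => //.
move=> k; apply: (@Ck_on_eq _ _ _ _ _
  ((f \o chart_inv d) \o (chart_map d \o F \o chart_inv c))).
- by apply: chart_image_open => // y [].
- by move=> y /set_mem[z [cz dz] <-] /=; rewrite chart_mapK// chart_mapK.
apply: (@Ck_on_comp _ _ _ _ _ (chart_map d @` chart_dom d)).
- by apply: chart_image_open => // y [].
- by move=> _ [z [cz dz] <-] /=; rewrite chart_mapK//; exists (F z).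
- exact: sF.
- exact: sf.
Qed.

Lemma smooth_real_sum (I : Type) (r : seq I) (P : pred I) (f : I -> M -> R) :
  (forall i, P i -> smooth_real (f i)) -> smooth_real (\sum_(i <- r | P i) f i).
Proof.
move=> H; elim/big_ind: _ => //; first exact: smooth_real_cst.
exact: smooth_realD.
Qed.

End Charts.

Section Division.
Context {R : realType} {n : nat} {M : manifold R n} {gT : finGroupType}.
Variables (to : {action gT &-> M}) (to_smooth : smooth_action to).

(** Pullback of [multi_newton] along [Z]. At [x' = to x g] each variable [F x' 0 l] equals the node
    of index [g], so the interpolation identity holds there, simultaneously for all [g] and with the
    same coefficients. *)
Lemma orbit_division m (F : M -> 'rV[R]_m) :
  (forall i, smooth_real (fun x => F x 0 i)) ->
  exists (T : finType) (E : T -> M -> R),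
    (forall t, smooth_real (E t)) /\
    forall w : 'rV[R]_m -> R, smooth_on setT w ->
    exists A : T -> M -> R, (forall t, smooth_real (A t)) /\
      forall x g, w (F (to x g)) = \sum_t A t x * E t (to x g).
Proof.
move=> sF; pose I : finType := ('I_m + 'I_m * gT)%type.
pose N := #|I|; pose er : I -> 'I_N := enum_rank.
(* Z x x' lists F x', followed by the nodes F (to x g) for all g. *)
pose Z x x' : 'rV[R]_N := \row_j match enum_val j : I with
  | inl l => F x' 0 l | inr (l, g) => F (to x g) 0 l end.
have Zl x x' l : Z x x' 0 (er (inl l)) = F x' 0 l by rewrite mxE enum_rankK.
have Zr x x' l g : Z x x' 0 (er (inr (l, g))) = F (to x g) 0 l.
  by rewrite mxE enum_rankK.
pose vs := [seq (er (inl l), [seq er (inr (l, g)) | g <- enum gT]) | l <- enum 'I_m].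
pose Y := [set er (inl l) | l : 'I_m]%SET.
have [||T [e [He H]]] := @multi_newton R N vs Y.
- by move=> v /mapP[l _ ->] /=; exact: imset_f.
- move=> v k /mapP[l _ ->] /= /mapP[g _ ->]; apply/imsetP => -[l' _].
  by move/enum_rank_inj.
have sZ j : smooth_real (fun x => Z x x 0 j).
  rewrite /Z; under eq_fun do rewrite mxE; case: (enum_val j : I) => [l|[l g]].
    exact: sF.
  exact: smooth_real_pull (to_smooth g) (sF l).
exists T, (fun t => e t \o (fun x => Z x x)); split.
  by move=> t; apply: smooth_real_comp => //; exact: (He t).1.
move=> w sw.
pose pr (z : 'rV[R]_N) : 'rV[R]_m := \row_l z 0 (er (inl l)).
have prlin : linear pr by move=> a u v; apply/rowP => j; rewrite !mxE.
have sf : smooth_on setT (w \o pr).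
  move=> k; apply: (Ck_on_comp openT _ _ (sw k)) => //.
  apply: Ck_on_row => [|i]; first exact: openT.
  rewrite (_ : (fun _ => _) = fun z : 'rV[R]_N => z 0 (er (inl i))).
    exact: Ck_on_proj.
  by apply/funext => z; rewrite mxE.
have [|a [Ha fa]] := H finset.set0 _ (finset.sub0set _) sf.
  by move=> z z' zz' /=; congr w; apply/rowP => j; rewrite !mxE zz'// inE.
exists (fun t => a t \o (fun x => Z x x)); split.
  by move=> t; apply: smooth_real_comp => //; exact: (Ha t).1.
move=> x g.
have -> : w (F (to x g)) = (w \o pr) (Z x (to x g)).
  by rewrite /=; congr w; apply/rowP => l; rewrite mxE Zl.
rewrite fa; last first.
  move=> v /mapP[l _ ->] /=; apply/hasP; exists (er (inr (l, g))).
    by apply/mapP; exists g => //; rewrite mem_enum.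
  by rewrite Zl Zr.
(* Coefficients ignore the variables and generators ignore the nodes, so [Z x (to x g)] may be
   replaced by [Z x x] in the former and by [Z (to x g) (to x g)] in the latter. This makes them
   functions of one point. *)
apply: eq_bigr => t _ /=; congr (_ * _).
  apply: (Ha t).2 => j; rewrite finset.set0U inE => jvs.
  rewrite !mxE; case ej: (enum_val j : I) => [l|//].
  case/negP: jvs; rewrite -(enum_valK j) ej.
  by apply/mapP; exists (er (inl l), [seq er (inr (l, g)) | g <- enum gT]) => //;
    apply/mapP; exists l; rewrite ?mem_enum.
apply: (He t).2 => j; rewrite !inE negbK => /imsetP[l _ ->].
by rewrite !Zl.
Qed.

End Division.

(** * Bump functions *)

Section Step.
Context {R : realType}.
Implicit Types p : {poly R}.

(* A family closed under derivation: the powers of 1 / t go into p. *)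
Definition flat p (t : R) : R :=
  if 0 < t then p.[t^-1] * expR (- t^-1) else 0.

(** Monomial by monomial, from [y ^+ i <= i! * expR y]; the summand 1 makes [C] positive even for
    [p = 0]. *)
Lemma poly_le_expR p : exists2 C, 0 < C &
  forall y : R, 0 <= y -> `|p.[y]| <= C * expR y.
Proof.
exists (1 + \sum_(i < size p) `|p`_i| * (i`!)%:R).
  by apply: ltr_pwDl => //; apply: sumr_ge0 => i _; rewrite mulr_ge0.
move=> y y0; rewrite horner_coef; apply: le_trans (ler_norm_sum _ _ _) _.
rewrite mulrDl mul1r; apply: ler_wpDl; first exact: expR_ge0.
rewrite mulr_suml; apply: ler_sum => i _; rewrite normrM -mulrA.
apply: ler_wpM2l => //; rewrite ger0_norm ?exprn_ge0//.
case: (nat_of_ord i) => [|k].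
  rewrite expr0 fact0 mul1r; apply: le_trans (expR_ge1Dx y); lra.
rewrite mulrC -ler_pdivrMr ?ltr0n ?fact_gt0//.
by apply: le_trans (expR_ge1Dxn k y0); rewrite lerDr.
Qed.

(** For [t > 0] the derivative of [t^-1] brings out the factor [t^-2], hence ['X^2]. At 0 the
    exponential beats every power of [t^-1]. *)
Lemma is_derive_flat p (t : R) :
  is_derive t 1 (flat p) (flat ('X^2 * (p - p^`())) t).
Proof.
have [t0|t0|<-] := ltgtP 0 t.
- have tn0 : t != 0 by rewrite gt_eqF.
  have d1 : is_derive t 1 (fun s : R => s^-1) (- t ^- 2).
    have := @is_deriveV R id t 1 1 tn0 (is_derive_id _ _).
    by rewrite /GRing.scale /= mulr1.
  have d2 : is_derive t 1 (fun s : R => p.[s^-1]) (p^`().[t^-1] * - t ^- 2).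
    exact: (@is_derive1_comp _ (horner p) (fun s => s^-1)).
  have d3 : is_derive t 1 (fun s : R => expR (- s^-1)) (expR (- t^-1) * t ^- 2).
    have dN := is_deriveN d1; rewrite opprK in dN.
    exact: (@is_derive1_comp _ expR (fun s => - s^-1)).
  have dM := is_deriveM d2 d3.
  apply: (@near_eq_is_derive _ _ _ ((fun s => p.[s^-1]) * (fun s => expR (- s^-1)))).
    near=> s; rewrite /flat !fctE ifT//; near: s.
    exact: lt_nbhsr.
  apply: (is_derive_eq dM); rewrite /flat t0 [LHS](_ : _ =
    p.[t^-1] * (expR (- t^-1) * t ^- 2) +
    expR (- t^-1) * (p^`().[t^-1] * - t ^- 2))//.
  by rewrite hornerM hornerD hornerN hornerXn exprVn; ring.
- rewrite [X in is_derive _ _ _ X](_ : _ = 0); last by rewrite /flat ltNge ltW.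
  apply: (@near_eq_is_derive _ _ _ (cst 0)) => //.
  near=> s; rewrite /flat ifF//; apply/negbTE; rewrite -leNgt; apply: ltW.
  by near: s; exact: lt_nbhsl.
rewrite [X in is_derive _ _ _ X](_ : _ = 0); last by rewrite /flat ltxx.
(* The two extra powers give [|flat p h| <= C * h ^+ 2] for [h > 0], which is little-o of [h]. *)
have [C C0 HC] := poly_le_expR ('X^2 * p).
have [df dfE] : differentiable (flat p) 0 /\
    'd (flat p) 0 = (\0%R : {linear R -> R}) :> (R -> R).
  apply: differentiable_estimate; first exact: cst_continuous.
  move=> e e0; near=> h.
  rewrite addr0 /flat ltxx /= !subr0; case: ifP => h0; last first.
    by rewrite normr0 mulr_ge0// ltW.
  rewrite normrM (ger0_norm (expR_ge0 _)) (gtr0_norm h0).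
  have hi : 0 <= h^-1 by rewrite invr_ge0 ltW.
  have := HC _ hi; rewrite hornerM hornerXn normrM ger0_norm ?exprn_ge0// => H.
  have E0 := expR_gt0 (h^-1); rewrite expRN.
  rewrite ler_pdivrMr//; apply: (@le_trans _ _ (h ^+ 2 * (C * expR h^-1))).
    rewrite -ler_pdivrMl ?exprn_gt0//.
    by rewrite -exprVn.
  rewrite mulrA; apply: ler_wpM2r; first exact: ltW.
  rewrite expr2 -mulrA mulrC; apply: ler_wpM2r; first exact: ltW.
  rewrite -ler_pdivlMr//; apply: ltW.
  apply: le_lt_trans (ler_norm h) _.
  have : ball (0 : R) (e / C) h by near: h; apply: nbhsx_ballx; rewrite divr_gt0.
  by rewrite -ball_normE /= sub0r normrN.
apply: DeriveDef; first exact: diff_derivable.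
by rewrite deriveE// dfE.
Unshelve. all: by end_near. Qed.

End Step.

Section SmoothStep.
Context {R : realType}.

(* For t <= 0 the inner factor flat 1 (1 - t) is at least flat 1 1 = exp (- 1). *)
Definition smooth_step (t : R) : R :=
  expR 1 * flat 1 (1 - expR 1 * flat 1 (1 - t)).

Lemma smooth_step1 (t : R) : 1 <= t -> smooth_step t = 1.
Proof.
move=> t1; rewrite /smooth_step {2}/flat ifF; last by apply/negbTE; lra.
by rewrite mulr0 subr0 /flat ltr01 invr1 hornerC mul1r -expRD subrr expR0.
Qed.

Lemma smooth_step0 (t : R) : t <= 0 -> smooth_step t = 0.
Proof.
move=> t0; rewrite /smooth_step {1}/flat ifF ?mulr0//; apply/negbTE.
have t1 : 0 < 1 - t by lra.
rewrite -leNgt subr_le0 /flat t1 hornerC mul1r -expRD.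
rewrite -[leLHS]expR0 ler_expR subr_ge0 invf_le1//; lra.
Qed.

Lemma Ck_on_smooth_step n k (U : set 'rV[R]_n) (g : 'rV[R]_n -> R) :
  open U -> Ck_on k U g -> Ck_on k U (smooth_step \o g).
Proof.
move=> oU Cg.
have Cflat (h : 'rV[R]_n -> R) : Ck_on k U h -> Ck_on k U (flat 1 \o h).
  apply: (@Ck_on_comp1 _ _ _ _ [set flat p | p in setT]) => //.
    move=> _ [p _ <-]; exists (flat ('X^2 * (p - p^`()))).
      by exists ('X^2 * (p - p^`())).
    exact: is_derive_flat.
have C1N (h : 'rV[R]_n -> R) : Ck_on k U h -> Ck_on k U (cst 1 - h).
  by move=> Ch; apply: Ck_onD => //; [exact: Ck_on_cst|exact: Ck_onN].
have Ce (h : 'rV[R]_n -> R) : Ck_on k U h -> Ck_on k U (cst (expR 1) * h).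
  by move=> Ch; apply: Ck_onM => //; exact: Ck_on_cst.
exact/Ce/Cflat/C1N/Ce/Cflat/C1N.
Qed.

Lemma bump_rV n (p : 'rV[R]_n) (r : R) : 0 < r ->
  exists b : 'rV[R]_n -> R, [/\ smooth_on setT b,
    forall y, b y != 0 -> ball p r y & \forall y \near p, b y = 1].
Proof.
(* [ball] refers to the sup norm, which is not smooth. The squared Euclidean distance [q] is, and it
   is at least [r ^+ 2] outside the ball; thus [g <= 0] there, while [g p = 2] exceeds 1. *)
move=> r0; pose q (y : 'rV[R]_n) := \sum_i (y 0 i - p 0 i) ^+ 2.
pose g y := 2 - 2 / r ^+ 2 * q y.
have Cq k : Ck_on k setT q.
  rewrite (_ : q = \sum_i ((fun y : 'rV[R]_n => y 0 i) + cst (- p 0 i)) *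
      ((fun y : 'rV[R]_n => y 0 i) + cst (- p 0 i))); last first.
    by apply/funext => y; rewrite fct_sumE.
  apply: Ck_on_sum => [|i _]; first exact: openT.
  by apply: Ck_onM; try exact: openT; apply: Ck_onD; try exact: openT;
    [exact: Ck_on_proj|exact: Ck_on_cst|exact: Ck_on_proj|exact: Ck_on_cst].
have Cg k : Ck_on k setT g.
  rewrite (_ : g = (cst 2 : 'rV[R]_n -> R) - cst (2 / r ^+ 2) * q)//.
  apply: Ck_onD; [exact: openT|exact: Ck_on_cst|].
  apply: Ck_onN; first exact: openT.
  by apply: Ck_onM; [exact: openT|exact: Ck_on_cst|].
exists (smooth_step \o g); split.
- by move=> k; apply: Ck_on_smooth_step => //; exact: openT.
- move=> y; apply: contraNP => /= yr; apply/eqP/smooth_step0.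
  have [i ri] : exists i, r <= `|y 0 i - p 0 i|.
    apply: contrapT => H; apply: yr; rewrite -ball_normE /=.
    rewrite [ltLHS]/Num.Def.normr/= mx_normrE; apply: bigmax_lt => // -[a i] _.
    rewrite ord1 !mxE distrC ltNge; apply/negP => ri.
    by apply: H; exists i.
  rewrite /g subr_le0 mulrAC ler_pdivlMr ?exprn_gt0// ler_pM2l//.
  rewrite /q (bigD1 i)//= -[leLHS]addr0; apply: lerD.
    by rewrite -[leRHS]real_normK ?num_real// ler_pXn2r// nnegrE ltW.
  by apply: sumr_ge0 => j _; exact: sqr_ge0.
- have cg : {for p, continuous g} by exact: (Cg 0%N).
  have gp : 1 < g p.
    rewrite /g /q big1 ?mulr0 ?subr0; last by move=> i _; rewrite subrr expr0n.
    lra.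
  have : \forall y \near p, 1 < g y by exact: (cg _ (lt_nbhsr gp)).
  by apply: filterS => y gy; apply: smooth_step1; exact: ltW.
Qed.

End SmoothStep.

(** This stands in for the extraction of finite subcovers. *)
Lemma compact_induction (T : topologicalType) (K : set T) (P : set T -> Prop) :
  compact K -> P set0 -> (forall A B, P A -> P B -> P (A `|` B)) ->
  (forall A B, A `<=` B -> P B -> P A) ->
  (forall x, K x -> exists2 U, nbhs x U & P U) -> P K.
Proof.
move=> cK P0 PU Psub Pn; apply: contrapT => nPK.
(* If P K fails, the sets A such that P (K `\` A) form a proper filter. *)
pose F : set_system T := [set A | P (K `\` A)].
have FF : ProperFilter F.
  split; first by rewrite /F /= setD0.
  split.
  - by rewrite /F /= setDT.
  - by move=> A B FA FB; rewrite /F /= setDIr; exact: PU.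
  - by move=> A B AB; rewrite /F /=; apply: Psub => x [Kx nB]; split=> // /AB.
have [|x [Kx xF]] := cK F FF; first by rewrite /F /= setDv.
have [U Ux PU'] := Pn _ Kx.
have FU : F (~` U) by rewrite /F /= setDE setCK; apply: Psub PU' => y [].
by have [y []] := xF _ _ FU Ux.
Qed.

Section Bumps.
Context {R : realType} {n : nat} {M : manifold R n}.
Implicit Types (c d : chart R n M) (W L : set M).

Let hM := @manifold_hausdorff R n M.

Definition chart_ext c (h : 'rV[R]_n -> R) (x : M) : R :=
  if `[< chart_dom c x >] then h (chart_map c x) else 0.

Lemma chart_extE c h x : chart_dom c x -> chart_ext c h x = h (chart_map c x).
Proof. by move=> cx; rewrite /chart_ext asboolT. Qed.

Lemma chart_image_compact c L : L `<=` chart_dom c -> compact L ->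
  compact (chart_map c @` L).
Proof.
move=> Lc; apply: continuous_compact.
apply: continuous_in_subspaceT => x /set_mem Lx.
exact/chart_map_at/Lc.
Qed.

Lemma chart_preimage_compact c (B : set 'rV[R]_n) :
  B `<=` chart_map c @` chart_dom c -> compact B -> compact (chart_inv c @` B).
Proof.
move=> Bc; apply: continuous_compact.
apply: continuous_in_subspaceT => y /set_mem By.
exact/chart_inv_at/Bc.
Qed.

(** The complement of [L] and the chart domain cover [M], and the extension is 0 on the former.
    Closedness of [L] in the whole of [M] prevents a jump at the edge of the chart. *)
Lemma smooth_chart_ext c h L : atlas c -> closed L -> L `<=` chart_dom c ->
  (forall x, chart_ext c h x != 0 -> L x) ->
  smooth_on (chart_map c @` chart_dom c) h -> smooth_real (chart_ext c h).
Proof.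
move=> Ac cL Lc supp sh; apply: smooth_real_local => x.
have [cx|cx] := pselect (chart_dom c x).
  exists c, (chart_dom c); split => //; first exact: chart_dom_open.
  move=> k; apply: Ck_on_eq (sh k); first exact: chart_img_open.
  move=> y /set_mem /chart_invP[dy cy].
  by rewrite /= chart_extE// cy.
have [d Ad dx] := (atlasP M).1 x.
have oW : open (chart_dom d `&` ~` L).
  by apply: openI; [exact: chart_dom_open|exact: closed_openC].
exists d, (chart_dom d `&` ~` L); split => //.
- by split=> // /Lc.
move=> k; apply: (@Ck_on_eq _ _ _ _ _ (cst 0)); last exact: Ck_on_cst.
  by apply: chart_image_open => // y [].
move=> _ /set_mem[y [dy nLy] <-] /=; rewrite chart_mapK//; apply/esym/eqP.
by apply: contraPT (supp y) => h0; apply: contra_not nLy; exact.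
Qed.

Lemma bump_point x W : open W -> W x -> exists (b : M -> R) L,
  [/\ smooth_real b, compact L, L `<=` W, forall y, b y != 0 -> L y &
   \forall y \near x, b y = 1].
Proof.
move=> oW Wx; have [c Ac cx] := (atlasP M).1 x.
have oWc : open (W `&` chart_dom c) by apply: openI => //; exact: chart_dom_open.
have oV : open (chart_map c @` (W `&` chart_dom c)).
  by apply: chart_image_open => // y [].
have [r /= r0 rV] : nbhs_ball (chart_map c x) (chart_map c @` (W `&` chart_dom c)).
  by apply/nbhs_ballP/open_nbhs_nbhs; split => //; exists x.
have r20 : 0 < r / 2 by rewrite divr_gt0.
have [b [sb bsupp b1]] := bump_rV (chart_map c x) r20.
pose B := closed_ball (chart_map c x) (r / 2).
have BV : B `<=` chart_map c @` (W `&` chart_dom c).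
  apply: subset_trans rV => y; rewrite /B closed_ballE// /closed_ball_ /=.
  rewrite -ball_normE /= => H; apply: le_lt_trans H _.
  by rewrite ltr_pdivrMr// ltr_pMr// ltr1n.
have cB : compact B.
  apply: bounded_closed_compact; last exact: closed_ball_closed.
  exists (`|chart_map c x| + r / 2); split; first exact: num_real.
  move=> m rm y; rewrite /B closed_ballE// /closed_ball_ /= => yr.
  apply/ltW; apply: le_lt_trans rm.
  rewrite -(subKr (chart_map c x) y); apply: le_trans (ler_normB _ _) _.
  exact: lerD.
have cL : compact (chart_inv c @` B).
  apply: chart_preimage_compact cB.
  by apply: subset_trans BV _ => _ [y [Wy cy] <-]; exists y.
have supp y : chart_ext c b y != 0 -> (chart_inv c @` B) y.
  rewrite /chart_ext; case: asboolP => [cy|]; last by rewrite eqxx.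
  move=> /bsupp by'; exists (chart_map c y); last by rewrite chart_mapK.
  exact: subset_closed_ball by'.
have LW : chart_inv c @` B `<=` W `&` chart_dom c.
  by move=> _ [_ /BV[y [Wy cy] <-] <-]; rewrite chart_mapK.
exists (chart_ext c b), (chart_inv c @` B); split => //.
- apply: smooth_chart_ext supp _ => //; first exact: compact_closed.
    by move=> y /LW[].
  by move=> k; apply: Ck_on_subset (sb k).
- by move=> y /LW[].
- have : \forall y \near x, chart_dom c y.
    by apply: open_nbhs_nbhs; split => //; exact: chart_dom_open.
  have : \forall y \near x, b (chart_map c y) = 1 by exact: (chart_map_at cx b1).
  by apply: filterS2 => y b1y cy; rewrite chart_extE.
Qed.

Lemma bump_compact K W : compact K -> open W -> K `<=` W ->
  exists (b : M -> R) L U,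
  [/\ smooth_real b, compact L, L `<=` W, forall y, b y != 0 -> L y &
      [/\ open U, K `<=` U & forall y, U y -> b y = 1]].
Proof.
move=> cK oW KW; apply: (compact_induction cK (P := fun K =>
  exists (b : M -> R) L U,
  [/\ smooth_real b, compact L, L `<=` W, forall y, b y != 0 -> L y &
      [/\ open U, K `<=` U & forall y, U y -> b y = 1]])).
- exists (cst 0), set0, set0; split => //.
  - exact: smooth_real_cst.
  - exact: compact0.
  - by move=> y; rewrite /cst eqxx.
  - by split => //; exact: open0.
- move=> A B [b [L [U [sb cL LW bL [oU AU b1]]]]]
    [b' [L' [U' [sb' cL' LW' bL' [oU' BU' b1']]]]].
  (* This is [1 - (1 - b) * (1 - b')]: it equals 1 wherever [b] or [b'] does and vanishes where both
     do. *)
  exists (b + b' - b * b'), (L `|` L'), (U `|` U'); split.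
  + apply: smooth_realD; first exact: smooth_realD.
    exact/smooth_realN/smooth_realM.
  + exact: compactU.
  + by move=> y [/LW|/LW'].
  + move=> y; rewrite !fctE; have [->|] := eqVneq (b y) 0.
      by rewrite add0r mul0r subr0 => /bL'; right.
    by move=> /bL; left.
  + split; first exact: openU.
      by move=> y [/AU|/BU']; [left|right].
    move=> y [/b1 bE|/b1' bE]; rewrite !fctE bE; ring.
- move=> A B AB [b [L [U [sb cL LW bL [oU BU b1]]]]]; exists b, L, U; split => //.
  by split=> //; exact: subset_trans BU.
- move=> x /KW Wx; have [b [L [sb cL LW bL b1]]] := bump_point oW Wx.
  exists ([set y | b y = 1]^°); first exact: nbhs_interior.
  exists b, L, ([set y | b y = 1]^°); split => //; split => //.
    exact: open_interior.
  exact: interior_subset.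
Qed.

End Bumps.

(** * Pieces of a single colour *)

Section Push.
Context {R : realType} {n : nat} {M : manifold R n}.
Implicit Types c : chart R n M.

Definition chart_push c (f : M -> R) (y : 'rV[R]_n) : R :=
  if `[< (chart_map c @` chart_dom c) y >] then f (chart_inv c y) else 0.

Lemma smooth_chart_push c (f : M -> R) L : atlas c -> smooth_real f ->
  compact L -> L `<=` chart_dom c -> (forall x, f x != 0 -> L x) ->
  smooth_on setT (chart_push c f).
Proof.
move=> Ac sf cL Lc supp k; apply: Ck_on_local => y _.
have [cy|cy] := pselect ((chart_map c @` chart_dom c) y).
  exists (chart_map c @` chart_dom c); first by split => //; exact: chart_img_open.
  apply: Ck_on_eq (sf c Ac k); first exact: chart_img_open.
  by move=> z /set_mem cz; rewrite /chart_push asboolT.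
have clL : closed (chart_map c @` L).
  by apply: compact_closed; [exact: norm_hausdorff|exact: chart_image_compact].
exists (~` (chart_map c @` L)).
  split; first exact: closed_openC.
  by move=> [x Lx xy]; apply: cy; exists x => //; exact: Lc.
apply: (@Ck_on_eq _ _ _ _ _ (cst 0)); last exact: Ck_on_cst.
  exact: closed_openC.
move=> z /set_mem nz; rewrite /chart_push; case: asboolP => // -[x cx xz].
apply/esym/eqP; apply: contraPT nz => /supp; rewrite -xz chart_mapK// => Lx.
by apply; exists x.
Qed.

End Push.

Section Glue.
Context {R : realType} {n : nat} {M : manifold R n} {I : Type}.
Variable W : I -> set M.
Hypotheses (oW : forall i, open (W i))
  (disjW : forall i j x, W i x -> W j x -> i = j).

Definition glue (f : I -> M -> R) (x : M) : R :=
  if pselect (exists i, W i x) is left H then f (projT1 (cid H)) x else 0.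

Lemma glueE f i x : W i x -> glue f x = f i x.
Proof.
move=> Wx; rewrite /glue; case: pselect => [H|[]]; last by exists i.
by rewrite (disjW (projT2 (cid H)) Wx).
Qed.

Lemma glue0 f x : (forall i, W i x -> f i x = 0) -> glue f x = 0.
Proof.
by move=> H; rewrite /glue; case: pselect => // Hx; exact/H/(projT2 (cid Hx)).
Qed.

(** Points outside every [W i] may still be limits of infinitely many of them. Closedness of the
    union of the [L i] provides a neighbourhood of such a point on which the glued function is 0. *)
Lemma smooth_glue (f : I -> M -> R) (L : I -> set M) :
  (forall i, smooth_real (f i)) -> (forall i x, f i x != 0 -> L i x) ->
  (forall i, L i `<=` W i) -> closed (\bigcup_i L i) -> smooth_real (glue f).
Proof.
move=> sf supp LW cL; apply: smooth_real_local => x.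
have [d Ad dx] := (atlasP M).1 x.
have [[i Wx]|nW] := pselect (exists i, W i x).
  have oWd : open (W i `&` chart_dom d).
    by apply: openI; [exact: oW|exact: chart_dom_open].
  exists d, (W i `&` chart_dom d); split => //.
  move=> k; apply: (@Ck_on_eq _ _ _ _ _ (f i \o chart_inv d)).
  - by apply: chart_image_open => // y [].
  - by move=> _ /set_mem[y [Wy dy] <-] /=; rewrite chart_mapK// (glueE _ Wy).
  - apply: Ck_on_subset (sf i d Ad k) => _ [y [Wy dy] <-]; by exists y.
have oL : open (~` (\bigcup_i L i) `&` chart_dom d).
  by apply: openI; [exact: closed_openC|exact: chart_dom_open].
exists d, (~` (\bigcup_i L i) `&` chart_dom d); split => //.
  by split=> // -[i _ /LW Wx]; apply: nW; exists i.
move=> k; apply: (@Ck_on_eq _ _ _ _ _ (cst 0)); last exact: Ck_on_cst.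
  by apply: chart_image_open => // y [].
move=> _ /set_mem[y [nL dy] <-] /=; rewrite chart_mapK// glue0// => i Wy.
by apply/eqP; apply: contraPT nL => /supp Ly; apply; exists i.
Qed.

End Glue.

Section ColourClass.
Context {R : realType} {n : nat} {M : manifold R n} {I : Type}.
(** [lfW] is local finiteness in the form required by [smooth_glue]: closed sets shrunk inside the
    [W i] have a closed union. *)
Variables (lab : I -> nat) (c : I -> chart R n M) (W A : I -> set M).
Hypotheses (lab_inj : injective lab) (Ac : forall i, atlas (c i))
  (oW : forall i, open (W i)) (Wc : forall i, W i `<=` chart_dom (c i))
  (disjW : forall i j x, W i x -> W j x -> i = j)
  (lfW : forall L : I -> set M, (forall i, closed (L i)) ->
    (forall i, L i `<=` W i) -> closed (\bigcup_i L i))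
  (cA : forall i, compact (A i)) (AW : forall i, A i `<=` W i).

Let hM := @manifold_hausdorff R n M.

(* The last coordinate of z singles out the i whose label is within 1 / 2. *)
Definition spread (w : I -> 'rV[R]_n -> R) (z : 'rV[R]_(n + 1)) : R :=
  if pselect (exists i, `|rsubmx z 0 0 - (lab i)%:R| < 1 / 2) is left H
  then w (projT1 (cid H)) (lsubmx z) *
    smooth_step (1 - 9 * (rsubmx z 0 0 - (lab (projT1 (cid H)))%:R) ^+ 2)
  else 0.

Lemma spreadE w i z : `|rsubmx z 0 0 - (lab i)%:R| < 1 / 2 ->
  spread w z = w i (lsubmx z) *
    smooth_step (1 - 9 * (rsubmx z 0 0 - (lab i)%:R) ^+ 2).
Proof.
move=> iz; rewrite /spread; case: pselect => [H|[]]; last by exists i.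
suff -> : projT1 (cid H) = i by [].
apply: lab_inj; move: (projT2 (cid H)); move: (projT1 _) => j jz.
have : `|(lab j)%:R - (lab i)%:R : R| < 1.
  rewrite -(subrKA (rsubmx z 0 0)) addrC; apply: le_lt_trans (ler_normD _ _) _.
  rewrite (distrC (lab j)%:R); lra.
rewrite ltr_norml => /andP[h1 h2].
by case: (ltngtP (lab j) (lab i)) => //;
  rewrite -(ler_nat R) -natr1 => h; exfalso; lra.
Qed.

(** The constant 9 makes the cutoff equal to 1 at a label and 0 from distance 1 / 3 on, before the
    zone of radius 1 / 2 around the label ends. *)
Lemma smooth_spread w : (forall i, smooth_on setT (w i)) ->
  smooth_on setT (spread w).
Proof.
move=> sw k; pose s (z : 'rV[R]_(n + 1)) := z 0 (rshift n (0 : 'I_1)).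
have sE z : rsubmx z 0 0 = s z by rewrite mxE.
have onear (a e : R) : open [set z | `|s z - a| < e].
  rewrite (_ : [set _ | _] = s @^-1` ball a e).
    apply: open_comp => [z _|]; first exact: coord_continuous.
    exact: ball_open.
  by apply/seteqP; split => z; rewrite -ball_normE /= distrC.
apply: Ck_on_local => z0 _.
have [[i iz0]|ni] := pselect (exists i, `|s z0 - (lab i)%:R| < 1 / 2).
  exists [set z | `|s z - (lab i)%:R| < 1 / 2] => //.
  have oN := onear (lab i)%:R (1 / 2).
  have Cs : Ck_on k [set z | `|s z - (lab i)%:R| < 1 / 2] (s + cst (- (lab i)%:R)).
    by apply: Ck_onD => //; [exact: Ck_on_proj|exact: Ck_on_cst].
  apply: (@Ck_on_eq _ _ _ _ _ ((w i \o lsubmx) *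
    (smooth_step \o (cst 1 + - (cst 9 *
       ((s + cst (- (lab i)%:R)) * (s + cst (- (lab i)%:R)))))))) => //.
    by move=> z /set_mem iz; rewrite (@spreadE _ i) ?sE// !fctE /= expr2.
  apply: Ck_onM => //.
    apply: (Ck_on_comp oN _ _ (sw i k)) => //; apply: Ck_on_row => // j.
    rewrite (_ : (fun _ => _) = fun z : 'rV[R]_(n + 1) => z 0 (lshift 1 j)).
      exact: Ck_on_proj.
    by apply/funext => z; rewrite mxE.
  apply: Ck_on_smooth_step => //; apply: Ck_onD => //; first exact: Ck_on_cst.
  apply: Ck_onN => //; apply: Ck_onM => //; first exact: Ck_on_cst.
  exact: Ck_onM.
(* 1 / 6 = 1 / 2 - 1 / 3: if [s z0] is at least 1 / 2 away from all labels, nearby points are at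
   least 1 / 3 away and the cutoff is 0. *)
exists [set z | `|s z - s z0| < 1 / 6].
  by split => //; rewrite /= subrr normr0; lra.
apply: (@Ck_on_eq _ _ _ _ _ (cst 0)) => //; last exact: Ck_on_cst.
move=> z /set_mem /= zz0; have [[i iz]|nz] := pselect
  (exists i, `|rsubmx z 0 0 - (lab i)%:R| < 1 / 2); last first.
  by rewrite /spread; case: pselect => // H; case: nz.
rewrite (@spreadE _ i)// smooth_step0 ?mulr0// sE.
have : 1 / 2 <= `|s z0 - (lab i)%:R|.
  by rewrite leNgt; apply/negP => H; apply: ni; exists i.
have H1 := ler_distD (s z) (s z0) (lab i)%:R; rewrite distrC in zz0.
rewrite -[(s z - _) ^+ 2]real_normK ?num_real// => H2.
have : 1 / 3 <= `|s z - (lab i)%:R| by lra.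
move: `|s z - _| => t t3; nra.
Qed.

(** The charts and the labels are multiplied by cutoffs [chi i], which makes them smooth on [M].
    Where [rho] is nonzero the cutoff is 1, so [F] returns the true chart coordinates and the true
    label, and both the chart and the point can be recovered from it. *)
Lemma colour_class : exists (rho : M -> R) (F : M -> 'rV[R]_(n + 1)),
  [/\ smooth_real rho, forall i, smooth_real (fun x => F x 0 i),
    forall i x, A i x -> rho x = 1 &
    forall u : M -> R, smooth_real u ->
      exists2 w : 'rV[R]_(n + 1) -> R, smooth_on setT w &
        forall x, rho x != 0 -> w (F x) = u x].
Proof.
have [chi Hchi] := choice (fun i => bump_compact (@cA i) (oW i) (@AW i)).
have [L {}Hchi] := choice Hchi; have [U {}Hchi] := choice Hchi.
(* chi i is equal to 1 on U i, which contains the support of r i. *)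
have Hrho i : exists (b : M -> R) L, [/\ smooth_real b, compact L, L `<=` U i,
    forall y, b y != 0 -> L y & forall y, A i y -> b y = 1].
  have [_ _ _ _ [oU AU _]] := Hchi i.
  have [b [L' [U' [sb cL LU bL [_ AU' b1]]]]] := bump_compact (@cA i) oU AU.
  by exists b, L'; split => // y /AU'; exact: b1.
have {Hrho} [r Hr] := choice Hrho; have [L' {}Hr] := choice Hr.
have UW i : U i `<=` W i.
  have [_ _ LW cL [_ _ U1]] := Hchi i => x /U1 cx; apply/LW/cL.
  by rewrite cx oner_neq0.
have clL i : closed (L i) by have [_ cL _ _ _] := Hchi i; exact: compact_closed.
have clL' i : closed (L' i) by have [_ cL _ _ _] := Hr i; exact: compact_closed.
have LW i : L i `<=` W i by have [_ _ LW _ _] := Hchi i.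
have LL : closed (\bigcup_i L i) by exact: lfW.
pose y_ j i := chart_ext (c i)
  ((chi i \o chart_inv (c i)) * (fun y : 'rV[R]_n => y 0 j)).
pose s_ i : M -> R := cst ((lab i)%:R : R) * chi i.
have Ey j i x : W i x -> y_ j i x = chi i x * chart_map (c i) x 0 j.
  by move=> /Wc cx; rewrite /y_ chart_extE// fctE /= chart_mapK.
have sy j i : smooth_real (y_ j i).
  have [sc cL _ supp _] := Hchi i.
  apply: (@smooth_chart_ext _ _ _ _ _ (L i)) => //.
  - by move=> x /LW /Wc.
  - move=> x; rewrite /y_ /chart_ext; case: asboolP => [cx|]; last by rewrite eqxx.
    rewrite fctE /= chart_mapK// mulf_eq0 negb_or => /andP[+ _]; exact: supp.
  - move=> k; apply: Ck_onM; [exact: chart_img_open|exact: sc|exact: Ck_on_proj].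
have suppy j i x : y_ j i x != 0 -> L i x.
  have [_ _ _ supp _] := Hchi i.
  rewrite /y_ /chart_ext; case: asboolP => [cx|]; last by rewrite eqxx.
  rewrite fctE /= chart_mapK// mulf_eq0 negb_or => /andP[+ _]; exact: supp.
pose F (x : M) : 'rV[R]_(n + 1) :=
  row_mx (\row_j glue W (y_ j) x) (\row_j glue W s_ x).
have lF x i : W i x -> lsubmx (F x) = \row_j (chi i x * chart_map (c i) x 0 j).
  by move=> Wx; apply/rowP => j; rewrite row_mxKl !mxE (glueE disjW _ Wx) Ey.
have rF x i : W i x -> rsubmx (F x) 0 0 = (lab i)%:R * chi i x.
  by move=> Wx; rewrite row_mxKr !mxE (glueE disjW _ Wx).
exists (glue W r), F; split.
- apply: (smooth_glue oW disjW (L := L')).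
  + by move=> i; have [] := Hr i.
  + by move=> i; have [] := Hr i.
  + by move=> i; have [_ _ LU _ _] := Hr i; apply: subset_trans LU (UW i).
  + apply: lfW => // i; have [_ _ LU _ _] := Hr i; exact: subset_trans LU (UW i).
- move=> j; rewrite (_ : (fun x => F x 0 j) =
      if fintype.split j is inl j' then glue W (y_ j') else glue W s_); last first.
    by apply/funext => x; rewrite mxE; case: (fintype.split _) => a; rewrite mxE.
  case: (fintype.split _) => a; apply: (smooth_glue oW disjW (L := L)) => //.
  + exact: suppy.
  + move=> i; have [sc _ _ _ _] := Hchi i; apply: smooth_realM => //.
    exact: smooth_real_cst.
  + move=> i x; have [_ _ _ supp _] := Hchi i.
    rewrite /s_ fctE mulf_eq0 negb_or => /andP[_]; exact: supp.
- move=> i x Ax; rewrite (glueE disjW _ (AW Ax)).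
  by have [_ _ _ _] := Hr i; apply.
(* In a chart, [u] need not extend smoothly to R^n, but [chi i * u] has compact support there and
   extends by zero. *)
move=> u su; exists (spread (fun i => chart_push (c i) (chi i * u))).
  apply: smooth_spread => i; have [sc cL _ supp _] := Hchi i.
  apply: (@smooth_chart_push _ _ _ _ _ (L i)) => //.
  - exact: smooth_realM.
  - by move=> x /LW /Wc.
  - move=> x; rewrite fctE mulf_eq0 negb_or => /andP[+ _]; exact: supp.
move=> x rx.
have [i Wx] : exists i, W i x.
  apply: contrapT => nW; case/eqP: rx; rewrite glue0// => i Wx.
  by case: nW; exists i.
rewrite (glueE disjW _ Wx) in rx.
have [_ _ LU rL _] := Hr i; have Ux := LU _ (rL _ rx).
have [_ _ _ _ [_ _ /(_ _ Ux) c1]] := Hchi i.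
have rE : rsubmx (F x) 0 0 = (lab i)%:R by rewrite (rF _ _ Wx) c1 mulr1.
have lE : lsubmx (F x) = chart_map (c i) x.
  by rewrite (lF _ _ Wx); apply/rowP => j; rewrite mxE c1 mul1r.
rewrite (@spreadE _ i); last by rewrite rE subrr normr0; lra.
rewrite rE lE subrr expr0n mulr0 subr0 smooth_step1// mulr1 /chart_push.
have cx := Wc Wx; rewrite asboolT; last by exists x.
by rewrite chart_mapK// fctE c1 mul1r.
Qed.

End ColourClass.

(** * Colouring compact sets *)

Section FiniteFamilies.
Context {T : topologicalType} {I : finType}.

Lemma compact_fin_bigcup (K : I -> set T) :
  (forall i, compact (K i)) -> compact (\bigcup_i K i).
Proof.
move=> cK; apply/compact_near_coveringP => J F P FF cov.
have H i : \forall j \near F, K i `<=` P j.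
  have := (compact_near_coveringP (K i)).1 (@cK i) J F P FF.
  by apply => x Kx; apply: cov; exists i.
have H' : \forall j \near F, forall i, K i `<=` P j by exact: filter_forall.
by apply: filterS H' => j Kj x [i _ Kx]; exact: Kj Kx.
Qed.

Lemma open_fin_forall (W : I -> set T) :
  (forall i, open (W i)) -> open [set x | forall i, W i x].
Proof.
move=> oW; rewrite openE => x Wx; apply: filter_forall => i.
exact: open_nbhs_nbhs.
Qed.

End FiniteFamilies.

Section Separation.
Context {T : topologicalType}.
Hypothesis hT : hausdorff_space T.

Lemma compact_separate (A B : set T) : compact A -> compact B ->
  (forall x, A x -> ~ B x) ->
  exists U V, [/\ open U, open V, A `<=` U, B `<=` V & forall x, U x -> ~ V x].
Proof.
move=> cA cB AB.
have Hp x : A x -> exists U V,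
    [/\ open U, open V, U x, B `<=` V & forall x, U x -> ~ V x].
  move=> Ax; apply: (compact_induction cB (P := fun B => exists U V,
    [/\ open U, open V, U x, B `<=` V & forall x, U x -> ~ V x])).
  - exists setT, set0.
    by split; [exact: openT|exact: open0|by []|by []|by move=> ? _].
  - move=> B1 B2 [U1 [V1 [oU1 oV1 U1x BV1 UV1]]] [U2 [V2 [oU2 oV2 U2x BV2 UV2]]].
    exists (U1 `&` U2), (V1 `|` V2); split.
    + exact: openI.
    + exact: openU.
    + by [].
    + by move=> y [/BV1|/BV2]; [left|right].
    + by move=> y [/UV1 ? /UV2 ?] [].
  - move=> B1 B2 B12 [U [V [oU oV Ux BV UV]]].
    by exists U, V; split => // y /B12 /BV.
  - move=> y By; have xy : x != y.
      by apply/eqP => xy; apply: (AB x) => //; rewrite xy.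
    have := hT; rewrite open_hausdorff.
    move=> /(_ _ _ xy)[[U V] /= [xU yV] [oU oV /eqP UV]].
    exists V; first by apply: open_nbhs_nbhs; split => //; exact: set_mem.
    exists U, V; split => //; first exact: set_mem.
    by move=> z Uz Vz; have : (U `&` V) z by []; rewrite UV.
apply: (compact_induction cA (P := fun A => exists U V,
    [/\ open U, open V, A `<=` U, B `<=` V & forall x, U x -> ~ V x])).
- by exists set0, setT; split; [exact: open0|exact: openT|by []|by []|by []].
- move=> B1 B2 [U1 [V1 [oU1 oV1 U1x BV1 UV1]]] [U2 [V2 [oU2 oV2 U2x BV2 UV2]]].
  exists (U1 `|` U2), (V1 `&` V2); split.
  + exact: openU.
  + exact: openI.
  + by move=> y [/U1x|/U2x]; [left|right].
  + by move=> y By; split; [exact: BV1|exact: BV2].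
  + by move=> y [/UV1 ?|/UV2 ?] [].
- by move=> B1 B2 B12 [U [V [oU oV BU BV UV]]]; exists U, V; split => // y /B12 /BU.
- move=> x /Hp[U [V [oU oV Ux BV UV]]]; exists U; first exact: open_nbhs_nbhs.
  by exists U, V; split.
Qed.

Lemma compact_family_separate (I : finType) (K P : I -> set T) :
  (forall i, compact (K i)) -> (forall i, open (P i)) ->
  (forall i, K i `<=` P i) -> (forall i j x, K i x -> K j x -> i = j) ->
  exists W : I -> set T, [/\ forall i, open (W i), forall i, K i `<=` W i,
    forall i, W i `<=` P i & forall i j x, W i x -> W j x -> i = j].
Proof.
move=> cK oP KP dK.
have H (ij : I * I) : exists UV : set T * set T, [/\ open UV.1, open UV.2,
    K ij.1 `<=` UV.1, K ij.2 `<=` UV.2 &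
    ij.1 != ij.2 -> forall x, UV.1 x -> ~ UV.2 x].
  case: (eqVneq ij.1 ij.2) => [e|ne].
    by exists (setT, setT); split => //=; exact: openT.
  have [x K1 K2|U [V [oU oV KU KV UV]]] := compact_separate (cK ij.1) (cK ij.2).
    by move/eqP: ne; apply; exact: dK K2.
  by exists (U, V); split.
have {H} [S HS] := choice H.
(* Both orders of the pair are used, so that [W i] lies in the first separating set of [(i, j)] and
   [W j] in the second. Diagonal pairs carry [setT] and impose nothing. *)
pose Q i j := (S (i, j)).1 `&` (S (j, i)).2.
exists (fun i => P i `&` [set x | forall j, Q i j x]); split.
- move=> i; apply: openI => //; apply: open_fin_forall => j.
  by apply: openI; [have [] := HS (i, j)|have [] := HS (j, i)].
- move=> i x Kx; split; first exact: KP.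
  move=> j; have [_ _ K1 _ _] := HS (i, j); have [_ _ _ K2 _] := HS (j, i).
  by split; [exact: K1|exact: K2].
- by move=> i x [].
move=> i j x [_ Qi] [_ Qj]; apply/eqP/negPn/negP => ij.
have [_ _ _ _ /(_ ij x (Qi j).1)] := HS (i, j); apply; exact: (Qj i).2.
Qed.

End Separation.

Section Colourable.
Context {T : topologicalType} (C : finType).
Hypothesis hT : hausdorff_space T.

(* Ostrand's form of covering dimension less than #|C|, with compact pieces. *)
Definition colourable (A : set T) := forall O : set (set T),
  (forall x, A x -> exists2 W, open W /\ W x & O W) ->
  (forall W W', W' `<=` W -> O W -> O W') ->
  exists (I : finType) (K P : C -> I -> set T),
  [/\ forall j i, compact (K j i),
      forall j i, [/\ open (P j i), O (P j i) & K j i `<=` P j i],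
      forall j i i' x, K j i x -> K j i' x -> i = i' &
      forall x, A x -> exists j i, K j i x].

Lemma colourable0 : colourable set0.
Proof.
by move=> O _ _; exists void, (fun _ _ => set0), (fun _ _ => set0); split.
Qed.

(* The pieces KB of B have disjoint open enlargements WB.  If the pieces KA of A
   are so small that one meeting KB j v stays inside WB j v, then each KB j v can
   absorb the pieces of A of colour j meeting it, and no new colour is needed. *)
Lemma colourableU A B : colourable A -> colourable B -> colourable (A `|` B).
Proof.
move=> HA HB O covO hO.
have [x Bx||IB [KB [PB [cKB HPB dKB covB]]]] := HB O.
- by apply: covO; right.
- exact: hO.
have HW j : exists W : IB -> set T, [/\ forall i, open (W i),
    forall i, KB j i `<=` W i, forall i, W i `<=` PB j i &
    forall i i' x, W i x -> W i' x -> i = i'].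
  apply: compact_family_separate => //; first by move=> i; have [] := HPB j i.
    by move=> i; have [] := HPB j i.
  exact: dKB.
have {HW} [WB HWB] := choice HW.
pose O' W := O W /\ forall j i, (forall x, W x -> ~ KB j i x) \/ W `<=` WB j i.
have [x Ax|W W' W'W [OW HW]|IA [KA [PA [cKA HPA dKA covA]]]] := HA O'.
- have [W [oW Wx] OW] := covO x (or_introl Ax).
  (* A neighbourhood of [x] that is small enough: inside [WB j i] if [x] lies in [KB j i], and off
     the closed set [KB j i] otherwise. These are finitely many open conditions. *)
  pose Q (ji : C * IB) :=
    if `[< KB ji.1 ji.2 x >] then WB ji.1 ji.2 else ~` KB ji.1 ji.2.
  exists (W `&` [set y | forall ji, Q ji y]); first split.
  + apply: openI => //; apply: open_fin_forall => -[j i]; rewrite /Q /=.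
    case: asboolP => _; first by have [] := HWB j.
    by apply: closed_openC; exact: compact_closed hT (@cKB j i).
  + split => // -[j i]; rewrite /Q /=; case: asboolP => // Kx.
    by have [_ KW _ _] := HWB j; exact: KW.
  + split; first by apply: hO OW => y [].
    move=> j i; case: (pselect (KB j i x)) => Kx.
      by right=> y [_ /(_ (j, i))]; rewrite /Q /= asboolT.
    by left=> y [_ /(_ (j, i))]; rewrite /Q /= asboolF.
- split; first exact: hO OW.
  move=> j i; case: (HW j i) => [H|H]; [left|right].
    by move=> x /W'W; exact: H.
  exact: subset_trans H.
pose touch j u v := exists x, KA j u x /\ KB j v x.
have touchW j u v : touch j u v -> KA j u `<=` WB j v.
  have [ oP [OP HP] KP] := HPA j u; move=> [x [Kux Kvx]].
  case: (HP j v) => [/(_ x (KP x Kux)) //|PW]; exact: subset_trans PW.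
pose K j (i : IA + IB) : set T := match i with
  | inl u => if `[< exists v, touch j u v >] then set0 else KA j u
  | inr v => KB j v `|`
     \bigcup_u (if `[< touch j u v >] then KA j u else set0) end.
have KW j v : K j (inr v) `<=` WB j v.
  have [_ KW _ _] := HWB j => x [/KW //|[u _]].
  by case: asboolP => // t; exact: touchW.
have Kl j u x : K j (inl u) x -> KA j u x /\ ~ exists v, touch j u v.
  by rewrite /K; case: asboolP.
exists (IA + IB)%type, K, (fun j i => match i with
  | inl u => PA j u | inr v => WB j v end); split.
- move=> j [u|v] /=; first by case: asboolP => _ //; exact: compact0.
  apply: compactU => //; apply: compact_fin_bigcup => u.
  by case: asboolP => _ //; exact: compact0.
- move=> j [u|v].
    have [ oP [OP _] KP] := HPA j u; split => // x /Kl[Kx _]; exact: KP.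
  have [ oW _ WP _] := HWB j; have [_ OP _] := HPB j v; split => //.
  exact: hO OP.
- have lr j u v x : K j (inl u) x -> K j (inr v) x -> False.
    move=> /Kl[Kx nt] [Kvx|[u' _]]; first by apply: nt; exists v, x.
    case: asboolP => // t Kx'; apply: nt; exists v.
    by rewrite (dKA _ _ _ _ Kx Kx').
  move=> j [u|v] [u'|v'] x.
  + by move=> /Kl[Kx _] /Kl[Kx' _]; rewrite (dKA _ _ _ _ Kx Kx').
  + by move=> a b; case: (lr _ _ _ _ a b).
  + by move=> a b; case: (lr _ _ _ _ b a).
  + by have [_ _ _ dW] := HWB j; move=> /KW Wx /KW Wx'; rewrite (dW _ _ _ Wx Wx').
- move=> x [Ax|Bx]; last first.
    by have [j [v Kx]] := covB x Bx; exists j, (inr v); left.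
  have [j [u Kx]] := covA x Ax; exists j.
  have [[v t]|nt] := pselect (exists v, touch j u v).
    by exists (inr v); right; exists u => //; rewrite asboolT.
  by exists (inl u); rewrite /K asboolF.
Qed.

End Colourable.

Section ChartColouring.
Context {R : realType} {n : nat} {M : manifold R n}.
Implicit Types (c : chart R n M) (A : set M).

Let hM := @manifold_hausdorff R n M.

Lemma lebesgue_number c A (O : set (set M)) : compact A ->
  A `<=` chart_dom c ->
  (forall x, A x -> exists2 W, open W /\ W x & O W) ->
  exists2 r : R, 0 < r & forall y, (chart_map c @` A) y ->
    exists W, [/\ open W, O W &
      forall z, (chart_map c @` A) z -> ball y r z -> W (chart_inv c z)].
Proof.
move=> cA Ac covO; have cA' := chart_image_compact Ac cA.
(* Membership in the image is stated twice because the induction varies only the first occurrence;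
   the second is kept for all sets. *)
have : exists2 r : R, 0 < r & forall y, (chart_map c @` A) y ->
    (chart_map c @` A) y -> exists W, [/\ open W, O W &
      forall z, (chart_map c @` A) z -> ball y r z -> W (chart_inv c z)].
  apply: (compact_induction cA' (P := fun B => exists2 r : R, 0 < r &
    forall y, B y -> (chart_map c @` A) y -> exists W, [/\ open W, O W &
      forall z, (chart_map c @` A) z -> ball y r z -> W (chart_inv c z)])).
  - by exists 1.
  - move=> B1 B2 [r1 r10 H1] [r2 r20 H2]; exists (Num.min r1 r2).
      by rewrite lt_min r10.
    move=> y [/H1 H|/H2 H] /H[W [oW OW HW]]; exists W; split => // z Az yz.
      by apply: HW => //; apply: le_ball yz; rewrite ge_min lexx.
    by apply: HW => //; apply: le_ball yz; rewrite ge_min lexx orbT.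
  - by move=> B1 B2 B12 [r r0 H]; exists r => // y /B12; exact: H.
  - move=> _ [x Ax <-]; have [W [oW Wx] OW] := covO x Ax.
    have cx := Ac x Ax.
    have : \forall z \near chart_map c x, W (chart_inv c z).
      apply: (@chart_inv_at _ _ _ c (chart_map c x)); first by exists x.
      by rewrite chart_mapK//; exact: open_nbhs_nbhs.
    move=> /nbhs_ballP[r /= r0 Hr]; have r20 : 0 < r / 2 by rewrite divr_gt0.
    exists (ball (chart_map c x) (r / 2)); first exact: nbhsx_ballx.
    exists (r / 2) => // y xy _; exists W; split => // z _ yz; apply: Hr.
    rewrite [r]splitr; exact: ball_triangle xy yz.
by move=> [r r0 H]; exists r => // y Ay; exact: H.
Qed.

Lemma parity_eq (a b : nat) :
  odd a = odd b -> (a <= b.+1)%N -> (b <= a.+1)%N -> a = b.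
Proof.
move=> ab; case: (ltngtP a b) => // h h1 h2.
  have e : b = a.+1 by apply/eqP; rewrite eqn_leq h2 h.
  by move: ab; rewrite e /=; case: odd.
have e : a = b.+1 by apply/eqP; rewrite eqn_leq h1 h.
by move: ab; rewrite e /=; case: odd.
Qed.

(** The colour of a cube is the vector of parities of its indices. Closed cubes that meet have
    indices differing by at most 1 in every direction, so two of the same colour that meet
    coincide. *)
Lemma colourable_chart c A : compact A -> A `<=` chart_dom c ->
  colourable {ffun 'I_n -> bool} A.
Proof.
move=> cA Ac O covO hO.
(* If [A] is empty, [O] may be empty too. Otherwise [O] contains [set0], which serves below as the
   neighbourhood assigned to cubes missing the image of [A]. *)
have [A0|/set0P[x0 Ax0]] := eqVneq A set0.
  exists void, (fun _ _ => set0), (fun _ _ => set0); split => //.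
  by rewrite A0.
have O0 : O set0.
  by have [W _ OW] := covO _ Ax0; apply: hO OW.
have [r r0 Hr] := lebesgue_number cA Ac covO.
have cA' := chart_image_compact Ac cA; set A' := chart_map c @` A in cA' Hr.
have [B [_ HB]] := compact_bounded cA'.
pose b : R := `|B| + 1.
have Ab y i : A' y -> `|y 0 i| <= b.
  move=> Ay; apply: le_trans (HB b _ y Ay); last first.
    by rewrite /b; have := ler_norm B; lra.
  rewrite [leRHS]/Num.Def.normr/= mx_normrE.
  exact: (le_bigmax _ (fun k => `|y k.1 k.2|) (0, i)).
have b0 : 0 <= b by rewrite addr_ge0.
(* Two points of one closed cube are then at sup distance at most [r / 2 < r], within reach of the
   Lebesgue number. *)
pose h : R := r / 2; have h0 : 0 < h by rewrite divr_gt0.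
pose m := (Num.truncn ((b + b) / h)).+1.
pose cell (q : 'I_m) : set R := `[q%:R * h - b, q.+1%:R * h - b]%classic.
pose cube (q : {ffun 'I_n -> 'I_m}) : set 'rV[R]_n :=
  [set y | forall i, cell (q i) (y ord0 i)].
have ccube q : compact (cube q).
  have := @rV_compact R n (fun i => cell (q i)).
  by apply => i; exact: segment_compact.
pose par (q : {ffun 'I_n -> 'I_m}) := [ffun i => odd (q i)].
pose K (p : {ffun 'I_n -> bool}) q : set M :=
  if p == par q then chart_inv c @` (A' `&` cube q) else set0.
have sA' : A' `<=` chart_map c @` chart_dom c by move=> _ [x /Ac cx <-]; exists x.
have KP p q : exists P : set M, [/\ open P, O P & K p q `<=` P].
  have [[y [Ay qy]]|ne] := pselect (exists y, A' y /\ cube q y); last first.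
    exists set0; split => //; first exact: open0.
    by rewrite /K; case: eqP => [_ x [y Hy _]|_ //]; apply: ne; exists y.
  have [W [oW OW HW]] := Hr y Ay; exists W; split => //.
  rewrite /K; case: eqP => [_ x [z [Az qz] <-]|_ //]; apply: HW => //.
  rewrite -ball_normE /= [ltLHS]/Num.Def.normr/= mx_normrE.
  apply: bigmax_lt => // -[a i] _ /=; rewrite ord1 !mxE.
  have := qy i; have := qz i; rewrite /cell /= !in_itv /= -!natr1 !mulrDl mul1r.
  move=> /andP[z1 z2] /andP[y1 y2].
  by rewrite ltr_norml; apply/andP; split; rewrite /h in z1 z2 y1 y2; lra.
have {KP} [P HP] := choice (fun pq :
  {ffun 'I_n -> bool} * {ffun 'I_n -> 'I_m} => KP pq.1 pq.2).
exists {ffun 'I_n -> 'I_m}, K, (fun p q => P (p, q)); split.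
- move=> p q; rewrite /K; case: eqP => _; last exact: compact0.
  apply: chart_preimage_compact; first by move=> y [/sA'].
  by apply: compact_closedI => //; apply: compact_closed => //; exact: norm_hausdorff.
- by move=> p q; exact: (HP (p, q)).
- move=> p q q' x; rewrite /K; case: eqP => // pq; case: eqP => // pq'.
  move=> [y [Ay qy] yx] [y' [Ay' qy'] yx'].
  have e : y = y'.
    have [_ <-] := chart_invP (sA' _ Ay); have [_ <-] := chart_invP (sA' _ Ay').
    by rewrite yx yx'.
  rewrite -{}e in qy'; apply/ffunP => i; apply: val_inj => /=.
  have H (a a' : nat) : a%:R * h - b <= y ord0 i <= a.+1%:R * h - b ->
      a'%:R * h - b <= y ord0 i <= a'.+1%:R * h - b -> (a <= a'.+1)%N.
    move=> /andP[l1 _] /andP[_ l2]; rewrite -(ler_nat R) -(ler_pM2r h0); lra.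
  have q1 := qy i; have q2 := qy' i; rewrite /cell /= !in_itv /= in q1 q2.
  apply: parity_eq; [|exact: (H _ _ q1 q2)|exact: (H _ _ q2 q1)].
  by move: pq pq' => -> /ffunP/(_ i); rewrite !ffunE.
move=> x Ax; have cx := Ac x Ax; pose y : 'rV[R]_n := chart_map c x.
have Ay : A' y by exists x.
have yb (i : 'I_n) : 0 <= (y ord0 i + b) / h.
  rewrite divr_ge0// ?(ltW h0)//; have := Ab y i Ay.
  by rewrite ler_norml => /andP[]; lra.
have ym (i : 'I_n) : (Num.truncn ((y ord0 i + b) / h) < m)%N.
  rewrite ltnS; apply: Num.Theory.le_truncn; rewrite ler_pM2r ?invr_gt0// lerD2r.
  exact: le_trans (ler_norm _) (Ab y i Ay).
pose q := [ffun i => Ordinal (ym i)].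
exists (par q), q; rewrite /K eqxx; exists y; last by rewrite /y chart_mapK.
split => // i; rewrite /cell /= ffunE in_itv /=.
have := truncn_itv (yb i); rewrite ler_pdivlMr// ltr_pdivrMr//.
by move=> /andP[l1 l2]; apply/andP; split; lra.
Qed.

Lemma colourable_compact A : compact A -> colourable {ffun 'I_n -> bool} A.
Proof.
move=> cA.
(* An open cover of A need not cover a larger set: stay inside A. *)
have [B [cB AB BA HB]] : exists B, [/\ compact B, A `&` A `<=` B, B `<=` A &
    colourable {ffun 'I_n -> bool} B].
  apply: (compact_induction cA (P := fun A' => exists B, [/\ compact B,
    A' `&` A `<=` B, B `<=` A & colourable {ffun 'I_n -> bool} B])).
  - exists set0; split; [exact: compact0|by move=> x []|by []|exact: colourable0].
  - move=> A1 A2 [B1 [cB1 AB1 BA1 HB1]] [B2 [cB2 AB2 BA2 HB2]].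
    exists (B1 `|` B2); split.
    + exact: compactU.
    + by move=> x [[A1x|A2x] Ax]; [left; exact: AB1|right; exact: AB2].
    + by move=> x [/BA1|/BA2].
    + exact: colourableU.
  - move=> A1 A2 A12 [B [cB AB BA HB]]; exists B; split => //.
    by move=> x [/A12 A2x Ax]; exact: AB.
  - move=> x Ax; have [c _ cx] := (atlasP M).1 x.
    have [b [L [_ cL Lc bL b1]]] := bump_point (chart_dom_open c) cx.
    exists L.
      by apply: filterS b1 => y b1y; apply: bL; rewrite b1y oner_neq0.
    have cLA : compact (A `&` L).
      by apply: compact_closedI => //; exact: compact_closed.
    exists (A `&` L); split.
    + exact: cLA.
    + by move=> y [].
    + by move=> y [].
    + apply: (@colourable_chart c) => // y [_ /Lc]; exact.
suff -> : A = B by [].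
by apply/seteqP; split => // x Ax; exact: AB.
Qed.

End ChartColouring.

(** * Colouring the manifold *)

Section Exhaustion.
Context {R : realType} {n : nat} {M : manifold R n}.

Let hM := @manifold_hausdorff R n M.

Lemma compact_nbhd (x : M) : exists2 L, compact L & nbhs x L.
Proof.
have [b [L [_ cL _ bL b1]]] := bump_point (@openT M) (I : setT x).
by exists L => //; apply: filterS b1 => y b1y; apply: bL; rewrite b1y oner_neq0.
Qed.

(** Every point has a basic neighbourhood contained in a compact set. [D k] is a compact set
    containing the basic set numbered [k], if there is one, and is empty otherwise. *)
Lemma countable_compact_cover : exists D : nat -> set M,
  (forall i, compact (D i)) /\ forall x, exists i, (D i)^° x.
Proof.
have [B cB [oB bB]] := manifold_second_countable M.
have /countable_injP[f finj] := cB.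
have H k : exists D : set M, compact D /\
    forall b L, B b -> f b = k -> compact L -> b `<=` L -> b `<=` D.
  have [[b [L [Bb fb cL bL]]]|nb] := pselect (exists b L,
      [/\ B b, f b = k, compact L & b `<=` L]).
    exists L; split => // b' L' Bb' fb' _ _.
    suff -> : b' = b by [].
    by apply: finj; rewrite ?inE// fb' fb.
  exists set0; split; first exact: compact0.
  by move=> b L Bb fb cL bL; case: nb; exists b, L.
have {H} [D HD] := choice H; exists D; split => [i|x]; first by have [] := HD i.
have [L cL xL] := compact_nbhd x.
have [b [Bb bx] bL] := bB x L xL.
exists (f b); have [_ HDb] := HD (f b).
apply: filterS (HDb b L Bb erefl cL bL) _.
by apply: open_nbhs_nbhs; split => //; exact: oB.
Qed.

(** Each finite union of the [D i] lies in the interior of a longer one, by compactness; iterating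
    this choice gives the sequence. Starting from the empty union makes the first annulus all of
    [E 1]. *)
Lemma compact_exhaustion : exists E : nat -> set M,
  [/\ forall l, compact (E l), E 0%N = set0, forall l, E l `<=` (E l.+1)^° &
      forall x, exists l, E l x].
Proof.
have [D [cD covD]] := countable_compact_cover.
pose E m := \bigcup_(i in [set i | (i < m)%N]) D i.
have cE m : compact (E m).
  elim: m => [|m IH].
    rewrite (_ : E 0%N = set0); first exact: compact0.
    by apply/seteqP; split => // x [].
  rewrite (_ : E m.+1 = E m `|` D m); first exact: compactU.
  apply/seteqP; split => [x [i /= im Dx]|x [[i /= im Dx]|Dx]].
  - move: im; rewrite ltnS leq_eqVlt => /predU1P[im|im]; last by left; exists i.
    by right; rewrite -im.
  - by exists i => //=; exact: ltnW.
  - by exists m => //=; exact: ltnSn.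
have Emono m m' : (m <= m')%N -> E m `<=` E m'.
  by move=> mm' x [i /= im Dx]; exists i => //=; exact: leq_trans mm'.
have next m : exists m', (m < m')%N /\ E m `<=` (E m')^°.
  apply: (compact_induction (cE m) (P := fun A =>
    exists m', (m < m')%N /\ A `<=` (E m')^°)).
  - by exists m.+1; split.
  - move=> A1 A2 [m1 [mm1 H1]] [m2 [mm2 H2]]; exists (maxn m1 m2).
    split; first by rewrite leq_max mm1.
    move=> x [/H1|/H2]; apply: interiorS; apply: Emono.
      exact: leq_maxl.
    exact: leq_maxr.
  - by move=> A1 A2 A12 [m1 [mm1 H]]; exists m1; split => // x /A12 /H.
  - move=> x _; have [i Dix] := covD x; exists (D i)^°.
      exact: nbhs_interior.
    exists (maxn m i).+1; split; first by rewrite ltnS leq_maxl.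
    apply: interiorS => y Dy; exists i => //=.
    by rewrite ltnS leq_maxr.
have {next} [s Hs] := choice next.
pose e l := iter l s 0%N.
have le l : (l <= e l)%N.
  elim: l => // l IH /=; have [H _] := Hs (e l); exact: leq_ltn_trans H.
exists (fun l => E (e l)); split => //.
- by apply/seteqP; split => // x [].
- by move=> l; have [] := Hs (e l).
- move=> x; have [i Dix] := covD x; exists i.+1.
  exists i; last exact: interior_subset Dix.
  exact: le.
Qed.

End Exhaustion.

Lemma modn3_far (a b : nat) : (a < b)%N -> (a %% 3 = b %% 3)%N -> (a.+2 < b)%N.
Proof.
move=> ab /eqP; rewrite eq_sym eqn_mod_dvd ?(ltnW ab)// => /dvdn_leq.
by rewrite subn_gt0 ltn_subRL addnC => /(_ ab).
Qed.

Section FiniteAtlas.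
Context {R : realType} {n : nat} {M : manifold R n}.

Let hM := @manifold_hausdorff R n M.

Lemma coloured_pieces : exists (J : finType) (rho : J -> M -> R)
    (F : J -> M -> 'rV[R]_(n + 1)),
  [/\ forall j, smooth_real (rho j), forall j i, smooth_real (fun x => F j x 0 i),
    forall x, exists j, rho j x = 1 &
    forall j (u : M -> R), smooth_real u ->
      exists2 w : 'rV[R]_(n + 1) -> R, smooth_on setT w &
        forall x, rho j x != 0 -> w (F j x) = u x].
Proof.
have [E [cE E0 Eint covE]] := @compact_exhaustion R n M.
have Esub l : E l `<=` E l.+1 by move=> x /Eint; exact: interior_subset.
have Emono l m : (l <= m)%N -> E l `<=` E m.
  move=> /subnK <-; elim: (m - l)%N => // k IH; rewrite addSn.
  exact: subset_trans (Esub _).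
(* N l and N l' are disjoint as soon as l and l' differ by 3 or more. *)
pose A l := E l.+1 `&` ~` (E l)^°.
pose N l := (E l.+2)^° `&` ~` (E l.-1).
have cA l : compact (A l).
  by apply: compact_closedI => //; apply: open_closedC; exact: open_interior.
have oN l : open (N l).
  apply: openI; first exact: open_interior.
  by apply: closed_openC; exact: compact_closed.
have AN l : A l `<=` N l.
  move=> x [Ex nx]; split; first exact: Eint.
  by case: l Ex nx => [|l] _ nx /=; [rewrite E0|move=> /Eint].
have covA x : exists l, A l x.
  have [l] := covE x; elim: l => [|l IH]; first by rewrite E0.
  move=> Ex; have [/interior_subset /IH //|nx] := pselect ((E l)^° x).
  by exists l.
have Nfar l l' x : (l.+2 < l')%N -> N l x -> ~ N l' x.
  move=> ll' [/interior_subset Ex _] [_]; apply; apply: Emono Ex.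
  by case: l' ll'.
pose C := {ffun 'I_n -> bool}.
have HK l : exists (I : finType) (D : C -> I -> (set M * set M) * chart R n M),
  [/\ forall j i, [/\ compact (D j i).1.1, open (D j i).1.2,
         (D j i).1.1 `<=` (D j i).1.2 & (D j i).1.2 `<=` N l],
    forall j i, atlas (D j i).2 /\ (D j i).1.2 `<=` chart_dom (D j i).2,
    forall j i i' x, (D j i).1.2 x -> (D j i').1.2 x -> i = i' &
    forall x, A l x -> exists j i, (D j i).1.1 x].
  pose O (W : set M) := W `<=` N l /\ exists2 c, atlas c & W `<=` chart_dom c.
  have [x Ax|W W' W'W [WN [c Ac Wc]]|I [K [P [cK HP dK covK]]]] :=
    colourable_compact (@cA l) (O := O).
  - have [c Ac cx] := (atlasP M).1 x; exists (N l `&` chart_dom c).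
      split; first by apply: openI => //; exact: chart_dom_open.
      by split => //; exact: AN.
    by split=> [y []//|]; exists c => // y [].
  - split; first exact: subset_trans WN.
    by exists c => //; exact: subset_trans Wc.
  have HW j : exists W : I -> set M, [/\ forall i, open (W i),
      forall i, K j i `<=` W i, forall i, W i `<=` P j i &
      forall i i' x, W i x -> W i' x -> i = i'].
    apply: compact_family_separate => //.
    + by move=> i; have [] := HP j i.
    + by move=> i; have [] := HP j i.
    + exact: dK.
  have {HW} [W HW] := choice HW.
  have Hc (ji : C * I) : exists c : chart R n M,
      atlas c /\ P ji.1 ji.2 `<=` chart_dom c.
    by have [_ [_ [c Ac Pc]] _] := HP ji.1 ji.2; exists c.
  have {Hc} [c Hc] := choice Hc.
  exists I, (fun j i => (K j i, W j i, c (j, i))); split => //=.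
  - move=> j i; have [oW KW WP _] := HW j; have [_ [PN _] _] := HP j i.
    by split => //; exact: subset_trans (WP i) PN.
  - move=> j i; have [_ _ WP _] := HW j; have [Ac Pc] := Hc (j, i).
    by split => //; exact: subset_trans (WP i) Pc.
  - by move=> j i i' x; have [_ _ _ dW] := HW j; exact: dW.
have {HK} [I HI] := choice HK.
pose D l := projT1 (cid (HI l)); have HD l := projT2 (cid (HI l)).
rewrite -/(D _) in HD.
pose S : countType := {l : nat & I l}.
pose J : finType := (C * 'I_3)%type.
(* A final colour is a colour inside an annulus together with the residue modulo 3 of the annulus
   number. Every colour keeps the full index type [S]; indices with another residue carry empty
   sets. *)
pose on (j : J) (s : S) := ((tag s) %% 3 == j.2 :> nat)%N.
pose d (j : J) (s : S) := D (tag s) j.1 (tagged s).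
pose K (j : J) (s : S) := if on j s then (d j s).1.1 else set0.
pose W (j : J) (s : S) := if on j s then (d j s).1.2 else set0.
have WN j s : W j s `<=` N (tag s).
  rewrite /W; case: ifP => [_|_ x []//].
  by have [/(_ j.1 (tagged s))[]] := HD (tag s).
have Hj j : exists (rho : M -> R) (F : M -> 'rV[R]_(n + 1)),
  [/\ smooth_real rho, forall i, smooth_real (fun x => F x 0 i),
    forall s x, K j s x -> rho x = 1 &
    forall u : M -> R, smooth_real u ->
      exists2 w : 'rV[R]_(n + 1) -> R, smooth_on setT w &
        forall x, rho x != 0 -> w (F x) = u x].
  apply: (@colour_class _ _ _ S pickle (fun s => (d j s).2) (W j)).
  - exact: (pcan_inj pickleK).
  - by move=> s; have [_ /(_ j.1 (tagged s))[]] := HD (tag s).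
  - move=> s; rewrite /W; case: ifP => _; last exact: open0.
    by have [/(_ j.1 (tagged s))[]] := HD (tag s).
  - move=> s; rewrite /W; case: ifP => [_|_ x []//].
    by have [_ /(_ j.1 (tagged s))[]] := HD (tag s).
  - move=> s s' x Ws Ws'.
    have := WN _ _ _ Ws; have := WN _ _ _ Ws'; move: Ws Ws'.
    rewrite /W; case: ifP => // os; case: ifP => // os'; move: os os'.
    case: s => l i; case: s' => l' i'; rewrite /on /d /=.
    move=> /eqP e /eqP e' Di Di' Nl' Nl.
    have ll' : l = l'.
      have em : (l %% 3 = l' %% 3)%N by rewrite e e'.
      case: (ltngtP l l') => // h.
        by case: (Nfar l l' x) => //; exact: modn3_far.
      by case: (Nfar l' l x) => //; exact: modn3_far.
    move: i' Di'; rewrite -{}ll' => i' Di'.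
    by have [_ _ dD _] := HD l; rewrite (dD _ _ _ _ Di Di').
  - move=> L clL LW; rewrite -[X in closed X]setCK; apply: open_closedC.
    rewrite openE => x nLx; have [l0 /Eint Ex] := covE x.
    (* Local finiteness: near a point of [E l0] only annuli with number below [l0 + 3] matter,
       because [N l] avoids [E l.-1], which contains [E l0.+1] for larger [l]. Each of these annuli
       has finitely many pieces. *)
    have nL (l : 'I_l0.+3) : \forall y \near x, forall i : I l,
        ~ L (existT _ (l : nat) i) y.
      apply: filter_forall => i; apply: open_nbhs_nbhs; split.
        exact: closed_openC.
      by move=> Lx; apply: nLx; exists (existT _ (l : nat) i).
    have {}nL := filter_forall _ nL.
    have Ex' : \forall y \near x, (E l0.+1)^° y.
      by apply: open_nbhs_nbhs; split => //; exact: open_interior.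
    change (nbhs x (~` (\bigcup_i L i))); near=> y => -[[l i] _ Ly].
    have /interior_subset Ey : (E l0.+1)^° y by near: y.
    have nLy : forall (l : 'I_l0.+3) (i : I l), ~ L (existT _ (l : nat) i) y.
      near: y; exact: nL.
    have [l1|l1] := ltnP l l0.+3; first exact: (nLy (Ordinal l1) i).
    have [_ ] := WN _ _ _ (LW _ _ Ly); apply; apply: Emono Ey => /=.
    by rewrite -ltnS (ltn_predK l1) ltnW.
  - move=> s; rewrite /K; case: ifP => _; last exact: compact0.
    by have [/(_ j.1 (tagged s))[]] := HD (tag s).
  - move=> s; rewrite /K /W; case: ifP => [_|_ x []//].
    by have [/(_ j.1 (tagged s))[]] := HD (tag s).
have {Hj} [rho Hj] := choice Hj; have {Hj} [F Hj] := choice Hj.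
exists J, rho, F; split.
- by move=> j; have [] := Hj j.
- by move=> j; have [] := Hj j.
- move=> x; have [l Al] := covA x; have [_ _ _ /(_ x Al)[j [i Ki]]] := HD l.
  have lm : (l %% 3 < 3)%N by exact: ltn_pmod.
  exists (j, Ordinal lm); have [_ _ H _] := Hj (j, Ordinal lm).
  by apply: (H (existT _ l i)); rewrite /K /on /= eqxx.
- by move=> j; have [] := Hj j.
Unshelve. all: by end_near. Qed.

End FiniteAtlas.

(** * Generators *)

Section TotalAction.
Context {gT : finGroupType} {T : Type} (to : {action gT &-> T}).

Lemma total_actM x a b : to x (a * b)%g = to (to x a) b.
Proof. by case: to => f [fI fM]; apply: fM; rewrite inE. Qed.

(** The map [to ^~ 1] is injective, by the definition of an action, and idempotent, hence the
    identity. *)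
Lemma total_act1 x : to x 1%g = x.
Proof.
suff inj : injective (fun y => to y 1%g) by apply: inj; rewrite -total_actM mulg1.
by case: to => f [fI fM]; exact: fI.
Qed.

End TotalAction.

Section Generators.
Context {R : realType} {n : nat} {M : manifold R n}.

(** Telescoping instead of normalising by a sum: [s j] is the product of the [1 - rho i] over the
    [i] preceding [j], and the total is 1 minus the product of all [1 - rho j], which vanishes since
    some [rho j x] is 1. *)
Lemma smooth_partition (J : finType) (rho : J -> M -> R) :
  (forall j, smooth_real (rho j)) -> (forall x, exists j, rho j x = 1) ->
  exists s : J -> M -> R, (forall j, smooth_real (s j)) /\
    forall x, \sum_j rho j x * s j x = 1.
Proof.
move=> srho cov.
have [s [ss sE]] : exists s : J -> M -> R, (forall j, smooth_real (s j)) /\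
    forall x, \sum_(j <- enum J) rho j x * s j x =
      1 - \prod_(j <- enum J) (1 - rho j x).
  elim: (enum J) (enum_uniq J) => [_|j r IH /= /andP[jr /IH[s [ss sE]]]].
    exists (fun _ => cst 0); split; first by move=> j; exact: smooth_real_cst.
    by move=> x; rewrite !big_nil subrr.
  exists (fun i => if i == j then cst 1 else (cst 1 + - rho j) * s i); split.
    move=> i; case: ifP => _; first exact: smooth_real_cst.
    apply: smooth_realM => //; apply: smooth_realD; first exact: smooth_real_cst.
    exact: smooth_realN.
  move=> x; rewrite !big_cons eqxx mulr1 big_seq.
  rewrite (eq_bigr (fun i => (1 - rho j x) * (rho i x * s i x))).
    rewrite -big_seq -mulr_sumr sE; ring.
  move=> i ir; rewrite ifN; first by rewrite fctE mulrCA.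
  by apply: contraNneq jr => <-.
exists s; split => // x; have [j rj] := cov x.
rewrite -big_enum /= sE (bigD1_seq j) ?mem_enum ?enum_uniq//=.
by rewrite rj subrr mul0r subr0.
Qed.

Variables (gT : finGroupType) (to : {action gT &-> M}).
Hypothesis to_smooth : smooth_action to.

Lemma invariant_generators : exists (T : finType) (E : T -> M -> R),
  (forall t, smooth_real (E t)) /\
  forall u : M -> R, smooth_real u -> exists B : T -> M -> R,
  [/\ forall t, smooth_real (B t), forall t g x, B t (to x g) = B t x &
      forall x, u x = \sum_t B t x * E t x].
Proof.
have [J [rho [F [srho sF cov HF]]]] := @coloured_pieces R n M.
have [s [ss sE]] := smooth_partition srho cov.
have [T0 HT] := choice (fun j => orbit_division to_smooth (sF j)).
pose E0 j := projT1 (cid (HT j)).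
have HE j : (forall t, smooth_real (E0 j t)) /\
    forall w : 'rV[R]_(n + 1) -> R, smooth_on setT w ->
    exists A : T0 j -> M -> R, (forall t, smooth_real (A t)) /\
      forall x g, w (F j (to x g)) = \sum_t A t x * E0 j t (to x g).
  exact: (projT2 (cid (HT j))).
pose T : finType := {j : J & T0 j}.
exists T, (fun t => (rho (tag t) * s (tag t)) * E0 (tag t) (tagged t)); split.
  move=> t; apply: smooth_realM; first exact: smooth_realM.
  exact: (HE _).1.
move=> u su.
(* The factor [rho j] makes the identity true everywhere: where it vanishes both sides are 0, and
   elsewhere [u] agrees with [w] composed with [F j]. *)
have HA j : exists A : T0 j -> M -> R, (forall t, smooth_real (A t)) /\
    forall x g, rho j (to x g) * u (to x g) =
      rho j (to x g) * \sum_t A t x * E0 j t (to x g).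
  have [w sw wu] := HF j u su; have [A [sA HA]] := (HE j).2 w sw.
  exists A; split => // x g; rewrite -HA.
  by have [->|rn0] := eqVneq (rho j (to x g)) 0; [rewrite !mul0r|rewrite wu].
pose A (t : T) : M -> R := projT1 (cid (HA (tag t))) (tagged t).
have sA t : smooth_real (A t) by exact: (projT2 (cid (HA (tag t)))).1.
have uA x g : u (to x g) = \sum_(t : T) A t x *
    ((rho (tag t) * s (tag t)) * E0 (tag t) (tagged t)) (to x g).
  rewrite -[LHS]mul1r -(sE (to x g)) mulr_suml.
  under eq_bigr => j _ do rewrite mulrAC (projT2 (cid (HA j))).2 mulrAC mulr_sumr.
  rewrite sig_big_dep /=; apply: eq_bigr => -[j t] _ /=.
  by rewrite !fctE /A /= mulrCA.
pose c : R := #|gT|%:R^-1.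
exists (fun t => cst c * \sum_(h : gT) (A t \o (fun x => to x h))); split.
- move=> t; apply: smooth_realM; first exact: smooth_real_cst.
  by apply: smooth_real_sum => h _; exact: smooth_real_pull.
- move=> t g x; rewrite !fctE !fct_sumE; congr (_ * _).
  rewrite [RHS](reindex_inj (mulgI g)) /=.
  by apply: eq_bigr => h _ /=; rewrite total_actM.
move=> x.
(* [uA] at the point [to x h] with the group element [h^-1] brings the generator back to [x] and
   leaves only the coefficient at [to x h], so averaging over [h] affects the coefficients alone. *)
have uE h : u x = \sum_(t : T) A t (to x h) *
    ((rho (tag t) * s (tag t)) * E0 (tag t) (tagged t)) x.
  by have := uA (to x h) h^-1%g; rewrite -total_actM mulgV total_act1.
have gn0 : #|gT|%:R != 0 :> R.
  by rewrite pnatr_eq0 -lt0n; apply/card_gt0P; exists 1%g.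
transitivity (c * \sum_(h : gT) u x).
  by rewrite sumr_const -mulr_natl mulrA mulVf// mul1r.
under eq_bigr => h _ do rewrite (uE h).
rewrite exchange_big mulr_sumr; apply: eq_bigr => t _.
by rewrite -mulr_suml mulrA fctE fct_sumE.
Qed.

End Generators.

Theorem theoremD (R : realType) (n : nat) (V : manifold R n)
    (gT : finGroupType) (to : {action gT &-> V}) (to_smooth : smooth_action to) :
  finitely_generated (Cinfty_mod to).
Proof.
have [T [E [sE HE]]] := invariant_generators to_smooth.
have eP t : (fun x => (E t x)%:C)%C \in smooth_fun V.
  apply/asboolP; split; first exact: sE.
  exact: smooth_real_cst.
pose e t : Cinfty_mod to := exist (fun f => f \in smooth_fun V) _ (eP t).
exists #|T|, (fun i => e (enum_val i)) => u.
have /asboolP[sRe sIm] := valP (u : Cinfty V).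
have [B1 [sB1 iB1 uB1]] := HE _ sRe; have [B2 [sB2 iB2 uB2]] := HE _ sIm.
(* The same real generators serve the real and the imaginary part of [u]; the two families of real
   coefficients combine into complex ones. *)
have aP t : (fun x => (B1 t x +i* B2 t x)%C) \in smooth_fun V.
  by apply/asboolP; split; [exact: sB1|exact: sB2].
pose a0 t : Cinfty V := exist (fun f => f \in smooth_fun V) _ (aP t).
have aI t : a0 t \in invariant_fun to.
  by apply/asboolP => g x /=; rewrite iB1 iB2.
pose a t : Cinfty_inv to := exist (fun f => f \in invariant_fun to) _ (aI t).
exists (fun i => a (enum_val i)).
transitivity (\sum_t a t *: e t); last first.
  by rewrite -(big_enum_val (fun t => a t *: e t)).
have valE (r : seq T) (x : V) : \val (\sum_(t <- r) a t *: e t : Cinfty V) x =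
    \sum_(t <- r) (B1 t x +i* B2 t x)%C * (E t x)%:C%C.
  elim: r => [|t r IH]; first by rewrite !big_nil.
  by rewrite !big_cons -IH.
apply: val_inj; apply/funext => x.
rewrite valE; apply/eqP; rewrite eq_complex !raddf_sum /=.
apply/andP; split; apply/eqP; [rewrite uB1|rewrite uB2].
  by apply: eq_bigr => t _ /=; rewrite mulr0 subr0.
by apply: eq_bigr => t _ /=; rewrite mulr0 add0r.
Qed.
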